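(* Let $E$ be an Archimedean Riesz space. Then there exist a probability measure space $(X,\Sigma,\mu)$ and a lattice isomorphism of $E$ onto $L^0(\mu)$ if and only if $E$ is universally complete and there is a weak order unit $e>0$ of $E$ such that the principal ideal $E_e$ generated by $e$ admits a strictly positive order continuous linear functional $E_e\to\mathbf{R}$.
   Context: Write $x>0$ for $x\ge 0$, $x\neq 0$, and $E^+=\{x\in E:x\ge 0\}$. For $e>0$ in a Riesz space $E$, the principal ideal generated by $e$ is $E_e=\{y\in E:|y|\le\lambda e\text{ for some }\lambda\in\mathbf{R}\}$. A net $(x_\alpha)_{\alpha\in A}$ in $E$ is order convergent to $x\in E$ if there is a net $(y_\alpha)_{\alpha\in A}$ in $E$ with the same index set such that $y_\alpha\downarrow 0$ and $|x_\alpha-x|\le y_\alpha$ for all $\alpha$. The vector $e>0$ is a weak order unit if for each $x\in E$ there is a net with values in $E_e$ that is order convergent to $x$. $E$ is laterally complete if the supremum of every (pairwise) disjoint subset of $E^+$ exists in $E$. It is universally complete if it is laterally complete and Dedekind complete (every non-empty subset bounded above has a supremum). A linear functional $\varphi:E_e\to\mathbf{R}$ is strictly positive if $\varphi(x)>0$ whenever $x>0$. It is order continuous if $\varphi(x_\alpha)\to 0$ for every net $(x_\alpha)$ in $E_e$ that is order convergent to $0$ in $E_e$. A lattice isomorphism is an injective linear map preserving the lattice operations; ''onto'' means it is surjective. A probability measure space $(X,\Sigma,\mu)$ is a non-empty set $X$ with a $\sigma$-algebra $\Sigma$ and a $\sigma$-additive measure $\mu$ with $\mu(X)=1$. $L^0(\mu)$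 is the Riesz space of $\mu$-a.e. equivalence classes of measurable functions $X\to\mathbf{R}$ with the a.e. pointwise order. *)

(* Defs.v *)
From HB Require Import structures.
From mathcomp Require Import all_boot all_order all_algebra.
From mathcomp Require Import all_classical all_reals all_analysis.
From mathcomp Require Import measurable_realfun.

Set Implicit Arguments.
Unset Strict Implicit.
Unset Printing Implicit Defensive.

Import Order.TTheory GRing.Theory Num.Theory.
Import numFieldNormedType.Exports.

Local Open Scope classical_set_scope.
Local Open Scope ring_scope.

HB.mixin Record POrderedLmodule_isRiesz (R : realType) (E : Type)
    of GRing.Lmodule R E & Order.POrder ring_display E := {
  riesz_meet : E -> E -> E;
  riesz_join : E -> E -> E;
  riesz_lexI : forall x y z : E, (x <= riesz_meet y z) = (x <= y) && (x <= z);
  riesz_leUx : forall x y z : E, (riesz_join x y <= z) = (x <= z) && (y <= z);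
  riesz_leD2r : forall z x y : E, x <= y -> x + z <= y + z;
  riesz_scaler_ge0 : forall (a : R) (x : E), 0 <= a -> 0 <= x -> 0 <= a *: x
}.

#[short(type="rieszType")]
HB.structure Definition Riesz (R : realType) :=
  { E of GRing.Lmodule R E & Order.POrder ring_display E
       & POrderedLmodule_isRiesz R E }.

Arguments riesz_leD2r {R s} z [x y] _.
Arguments riesz_scaler_ge0 {R s} [a x] _ _.

Section RieszDefs.
Context {R : realType}.
Implicit Types E F : rieszType R.

Definition riesz_abs E (x : E) : E := riesz_join x (- x).

Definition riesz_disjoint E (x y : E) : Prop :=
  riesz_meet (riesz_abs x) (riesz_abs y) = 0.

Definition archimedean E : Prop :=
  forall x y : E, 0 <= x -> (forall n : nat, x *+ n <= y) -> x = 0.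

Definition dedekind_complete E : Prop :=
  forall A : set E, has_sup A -> exists s, isLub A s.

(* The empty set is excluded: its supremum would be a least element of E,
   which exists only if E is trivial. *)
Definition laterally_complete E : Prop :=
  forall D : set E, D !=set0 -> (forall x, D x -> 0 <= x) ->
    (forall x y, D x -> D y -> x <> y -> riesz_disjoint x y) ->
    exists s, isLub D s.

Definition universally_complete E : Prop :=
  laterally_complete E /\ dedekind_complete E.

(* As usual for nets, a directed set is a non-empty preordered set in which
   any two elements have an upper bound; antisymmetry is not required. *)
Definition directed (A : Type) (leA : A -> A -> Prop) : Prop :=
  [/\ exists a : A, True,
      forall a, leA a a,
      forall a b c, leA a b -> leA b c -> leA a c
    & forall a b, exists c, leA a c /\ leA b c].

Definition net_tails (A : Type) (leA : A -> A -> Prop) : set_system A :=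
  filter_from [set: A] (fun a => [set b | leA a b]).

Definition decreases_to0 E (A : Type) (leA : A -> A -> Prop) (y : A -> E) :=
  (forall a b, leA a b -> y b <= y a) /\ infimums (range y) 0.

Definition order_cvg E (A : Type) (leA : A -> A -> Prop) (u : A -> E) (x : E) :=
  exists y : A -> E,
    decreases_to0 leA y /\ forall a, riesz_abs (u a - x) <= y a.

(* This is stated for any e; it defines a Riesz subspace of E even when e is
   not positive. *)
Definition in_ideal E (e : E) : {pred E} :=
  mem [set y | exists l : R, riesz_abs y <= l *: e].

Definition weak_order_unit E (e : E) : Prop :=
  0 < e /\
  forall x : E, exists (A : Type) (leA : A -> A -> Prop) (u : A -> E),
    [/\ directed leA, forall a, u a \in in_ideal e & order_cvg leA u x].

Definition strictly_positive E (phi : {scalar E}) : Prop :=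
  forall x : E, 0 < x -> 0 < phi x.

Definition order_continuous E (phi : {scalar E}) : Prop :=
  forall (A : Type) (leA : A -> A -> Prop) (u : A -> E),
    directed leA -> order_cvg leA u 0 ->
    phi (u a) @[a --> net_tails leA] --> (0 : R).

Definition lattice_isomorphism E F (T : {linear E -> F}) : Prop :=
  [/\ injective T, {morph T : x y / riesz_meet x y}
    & {morph T : x y / riesz_join x y}].

End RieszDefs.

Section RieszTheory.
Context {R : realType} {E : rieszType R}.
Implicit Types x y z e : E.

Lemma riesz_leD x y z t : x <= y -> z <= t -> x + z <= y + t.
Proof.
move=> xy zt; apply: (le_trans (riesz_leD2r z xy)).
by rewrite ![y + _]addrC; exact: riesz_leD2r.
Qed.

Lemma riesz_subr_ge0 x y : (0 <= y - x) = (x <= y).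
Proof.
apply/idP/idP => [/(riesz_leD2r x)|/(riesz_leD2r (- x))].
  by rewrite add0r subrK.
by rewrite subrr.
Qed.

Lemma riesz_leN x y : (- x <= - y) = (y <= x).
Proof. by rewrite -(riesz_subr_ge0 (- x)) opprK addrC riesz_subr_ge0. Qed.

Lemma riesz_leZ (a : R) x y : 0 <= a -> x <= y -> a *: x <= a *: y.
Proof.
move=> a0; rewrite -riesz_subr_ge0 => xy.
by rewrite -(riesz_subr_ge0 (a *: x)) -scalerBr riesz_scaler_ge0.
Qed.

Lemma riesz_absP x z : (riesz_abs x <= z) = (- z <= x <= z).
Proof. by rewrite /riesz_abs riesz_leUx -(riesz_leN z (- x)) opprK andbC. Qed.

Lemma in_idealP e x :
  reflect (exists l : R, - (l *: e) <= x <= l *: e) (x \in in_ideal e).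
Proof.
apply: (iffP idP); rewrite inE => -[l]; first by rewrite riesz_absP; exists l.
by exists l; rewrite riesz_absP.
Qed.

Variable e : E.

Lemma in_ideal_submod_closed : submod_closed (in_ideal e).
Proof.
split.
  by apply/in_idealP; exists 0; rewrite scale0r oppr0 lexx.
move=> a x y /in_idealP[l /andP[lx xl]] /in_idealP[m /andP[my ym]].
apply/in_idealP; exists (`|a| * l + m).
rewrite scalerDl opprD -scalerA.
case: (ger0P a) => [a0|/ltW a0].
  rewrite -scalerN.
  by apply/andP; split; apply: riesz_leD => //; exact: riesz_leZ.
have Na0 : 0 <= - a by rewrite oppr_ge0.
have -> : a *: x = (- a) *: (- x) by rewrite scaleNr scalerN opprK.
rewrite -scalerN.
apply/andP; split; apply: riesz_leD => //; apply: riesz_leZ => //.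
  by rewrite riesz_leN.
by rewrite -riesz_leN opprK.
Qed.

HB.instance Definition _ :=
  GRing.isSubmodClosed.Build R E (in_ideal e) in_ideal_submod_closed.

Lemma in_ideal_max x y : x \in in_ideal e -> y \in in_ideal e ->
  exists l : R,
    [/\ - (l *: e) <= x, x <= l *: e, - (l *: e) <= y & y <= l *: e].
Proof.
have ge0 z (k : R) : - (k *: e) <= z <= k *: e -> 0 <= k *: e.
  move=> /andP[kz zk]; have := le_trans kz zk.
  rewrite -riesz_subr_ge0 opprK -mulr2n -scaler_nat => h.
  have /(riesz_scaler_ge0 (a := 2^-1)) := h.
  by rewrite scalerA mulVf ?pnatr_eq0// scale1r invr_ge0 ler0n => ->.
move=> /in_idealP[l xl] /in_idealP[m ym].
have l0 := ge0 _ _ xl; have m0 := ge0 _ _ ym.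
case/andP: xl ym => lx xl /andP[my ym].
have ll : l *: e <= (l + m) *: e.
  by rewrite scalerDl -[leLHS]addr0; exact: riesz_leD.
have mm : m *: e <= (l + m) *: e.
  by rewrite scalerDl -[leLHS]add0r; exact: riesz_leD.
exists (l + m); split.
- by apply: le_trans lx; rewrite riesz_leN.
- exact: le_trans ll.
- by apply: le_trans my; rewrite riesz_leN.
- exact: le_trans mm.
Qed.

Lemma in_ideal_meet x y : x \in in_ideal e -> y \in in_ideal e ->
  riesz_meet x y \in in_ideal e.
Proof.
move=> xe ye; have [l [lx xl ly yl]] := in_ideal_max xe ye.
apply/in_idealP; exists l; rewrite riesz_lexI lx ly /=.
have /andP[mx _] : (riesz_meet x y <= x) && (riesz_meet x y <= y).
  by rewrite -riesz_lexI.
exact: le_trans mx xl.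
Qed.

Lemma in_ideal_join x y : x \in in_ideal e -> y \in in_ideal e ->
  riesz_join x y \in in_ideal e.
Proof.
move=> xe ye; have [l [lx xl ly yl]] := in_ideal_max xe ye.
apply/in_idealP; exists l; rewrite riesz_leUx xl yl !andbT.
have /andP[xj _] : (x <= riesz_join x y) && (y <= riesz_join x y).
  by rewrite -riesz_leUx.
exact: le_trans lx xj.
Qed.

End RieszTheory.

Section PrincipalIdeal.
Context {R : realType} {E : rieszType R} (e : E).

Record principal_ideal : Type := PrincipalIdeal {
  ideal_val :> E;
  ideal_valP : ideal_val \in in_ideal e
}.

HB.instance Definition _ := [isSub of principal_ideal for ideal_val].
HB.instance Definition _ := [Choice of principal_ideal by <:].
HB.instance Definition _ := [SubChoice_isSubLmodule of principal_ideal by <:].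
HB.instance Definition _ :=
  [SubChoice_isSubPOrder of principal_ideal by <: with ring_display].

Implicit Types x y z : principal_ideal.

Definition ideal_meet x y :=
  PrincipalIdeal (in_ideal_meet (ideal_valP x) (ideal_valP y)).

Definition ideal_join x y :=
  PrincipalIdeal (in_ideal_join (ideal_valP x) (ideal_valP y)).

Let ideal_leE x y : (x <= y) = (ideal_val x <= ideal_val y).
Proof. by []. Qed.

Let ideal_lexI x y z : (x <= ideal_meet y z) = (x <= y) && (x <= z).
Proof. by rewrite !ideal_leE riesz_lexI. Qed.

Let ideal_leUx x y z : (ideal_join x y <= z) = (x <= z) && (y <= z).
Proof. by rewrite !ideal_leE riesz_leUx. Qed.

Let ideal_leD2r z x y : x <= y -> x + z <= y + z.
Proof. by rewrite !ideal_leE; exact: riesz_leD2r. Qed.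

Let ideal_scaler_ge0 (a : R) x : 0 <= a -> 0 <= x -> 0 <= a *: x.
Proof. by rewrite !ideal_leE; exact: riesz_scaler_ge0. Qed.

HB.instance Definition _ := POrderedLmodule_isRiesz.Build R principal_ideal
  ideal_lexI ideal_leUx ideal_leD2r ideal_scaler_ge0.

End PrincipalIdeal.

Section L0.
Context d (X : measurableType d) (R : realType).
Variable mu : {measure set X -> \bar R}.

(* On R, the library's measurable structure is the Borel sigma-algebra. *)
Definition L0 : Type := {mfun_ mu, X >-> R}.

HB.instance Definition _ := Choice.on L0.

Implicit Types (f g : {mfun X >-> R}) (u v w : L0).

(* The canonical surjection sends f to its class; L0_fun chooses a
   representative, so the operations and the order below are computed on
   representatives and do not depend on the choice (L0_classK). *)
Definition L0_class f : L0 := (\pi_{mfun_ mu, X >-> R} f)%qT.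
Definition L0_fun u : {mfun X >-> R} := repr u.

Definition L0_zero : L0 := L0_class 0.
Definition L0_opp u : L0 := L0_class (- L0_fun u).
Definition L0_add u v : L0 := L0_class (L0_fun u + L0_fun v).
Definition L0_scale (a : R) u : L0 := L0_class (a *: L0_fun u).
Definition L0_meet u v : L0 := L0_class (min_mfun (L0_fun u) (L0_fun v)).
Definition L0_join u v : L0 := L0_class (max_mfun (L0_fun u) (L0_fun v)).
Definition L0_le u v : bool :=
  `[< {ae mu, forall x, L0_fun u x <= L0_fun v x} >].

Let aeS (P Q : X -> Prop) : (forall x, P x -> Q x) ->
  {ae mu, forall x, P x} -> {ae mu, forall x, Q x}.
Proof. exact: filterS. Qed.

Let aeI (P Q : X -> Prop) : {ae mu, forall x, P x} ->
  {ae mu, forall x, Q x} -> {ae mu, forall x, P x /\ Q x}.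
Proof. exact: filterI. Qed.

Lemma L0_classK f : {ae mu, forall x, L0_fun (L0_class f) x = f x}.
Proof.
have /eqmodP/asboolP : (repr (L0_class f) = f %[mod {mfun_ mu, X >-> R}])%qT.
  by rewrite reprK.
by apply: aeS => x; exact.
Qed.

Lemma L0_funP u v : {ae mu, forall x, L0_fun u x = L0_fun v x} -> u = v.
Proof.
move=> uv; rewrite -[u]reprK -[v]reprK; apply/eqmodP/asboolP.
by apply: aeS uv => x xuv _.
Qed.

Lemma L0_leP u v :
  reflect {ae mu, forall x, L0_fun u x <= L0_fun v x} (L0_le u v).
Proof. exact: asboolP. Qed.

Let L0_oppE u : {ae mu, forall x, L0_fun (L0_opp u) x = - L0_fun u x}.
Proof. exact: L0_classK. Qed.

Let L0_addE u v :
  {ae mu, forall x, L0_fun (L0_add u v) x = L0_fun u x + L0_fun v x}.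
Proof. exact: L0_classK. Qed.

Let L0_scaleE a u :
  {ae mu, forall x, L0_fun (L0_scale a u) x = a * L0_fun u x}.
Proof. exact: L0_classK. Qed.

Let L0_addA : associative L0_add.
Proof.
move=> u v w; apply: L0_funP.
have := aeI (aeI (L0_addE u (L0_add v w)) (L0_addE v w))
          (aeI (L0_addE (L0_add u v) w) (L0_addE u v)).
by apply: aeS => x [[/= -> ->] [/= -> ->]]; rewrite addrA.
Qed.

Let L0_addC : commutative L0_add.
Proof.
move=> u v; apply: L0_funP.
by apply: aeS (aeI (L0_addE u v) (L0_addE v u)) => x [/= -> ->]; rewrite addrC.
Qed.

Let L0_add0 : left_id L0_zero L0_add.
Proof.
move=> u; apply: L0_funP.
apply: aeS (aeI (L0_addE L0_zero u) (L0_classK 0)) => x [/= -> ->].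
by rewrite add0r.
Qed.

Let L0_addN : left_inverse L0_zero L0_opp L0_add.
Proof.
move=> u; apply: L0_funP.
apply: aeS (aeI (L0_addE (L0_opp u) u) (aeI (L0_oppE u) (L0_classK 0))) => x.
by move=> [/= -> [-> ->]]; rewrite addNr.
Qed.

HB.instance Definition _ :=
  GRing.isZmodule.Build L0 L0_addA L0_addC L0_add0 L0_addN.

Let L0_scaleA a b u : L0_scale a (L0_scale b u) = L0_scale (a * b) u.
Proof.
apply: L0_funP.
have := aeI (L0_scaleE a (L0_scale b u))
          (aeI (L0_scaleE b u) (L0_scaleE (a * b) u)).
by apply: aeS => x [/= -> [-> ->]]; rewrite mulrA.
Qed.

Let L0_scale1 : left_id 1 L0_scale.
Proof.
move=> u; apply: L0_funP.
by apply: aeS (L0_scaleE 1 u) => x ->; rewrite mul1r.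
Qed.

Let L0_scaleDr : right_distributive L0_scale +%R.
Proof.
move=> a u v; apply: L0_funP.
have := aeI (aeI (L0_scaleE a (u + v)) (L0_addE u v))
          (aeI (L0_addE (L0_scale a u) (L0_scale a v))
            (aeI (L0_scaleE a u) (L0_scaleE a v))).
by apply: aeS => x [[/= -> ->] [-> [-> ->]]]; rewrite mulrDr.
Qed.

Let L0_scaleDl u : {morph L0_scale^~ u : a b / a + b}.
Proof.
move=> a b; apply: L0_funP.
have := aeI (L0_scaleE (a + b) u)
          (aeI (L0_addE (L0_scale a u) (L0_scale b u))
            (aeI (L0_scaleE a u) (L0_scaleE b u))).
by apply: aeS => x [/= -> [-> [-> ->]]]; rewrite mulrDl.
Qed.

HB.instance Definition _ := GRing.Zmodule_isLmodule.Build R L0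
  L0_scaleA L0_scale1 L0_scaleDr L0_scaleDl.

Let L0_le_refl : reflexive L0_le.
Proof. by move=> u; apply/L0_leP; exact: aeW. Qed.

Let L0_le_anti : antisymmetric L0_le.
Proof.
move=> u v /andP[/L0_leP uv /L0_leP vu]; apply: L0_funP.
by apply: aeS (aeI uv vu) => x [xuv xvu]; apply/eqP; rewrite eq_le xuv.
Qed.

Let L0_le_trans : transitive L0_le.
Proof.
move=> v u w /L0_leP uv /L0_leP vw; apply/L0_leP.
by apply: aeS (aeI uv vw) => x [xuv xvw]; exact: le_trans xvw.
Qed.

HB.instance Definition _ := Order.Le_isPOrder.Build ring_display L0
  L0_le_refl L0_le_anti L0_le_trans.

Let L0_lexI u v w : (u <= L0_meet v w) = (u <= v) && (u <= w).
Proof.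
have mE := L0_classK (min_mfun (L0_fun v) (L0_fun w)).
apply/L0_leP/andP => [h|[/L0_leP uv /L0_leP uw]].
  by split; apply/L0_leP; apply: aeS (aeI h mE) => x [+ E];
    rewrite E le_min => /andP[].
by apply: aeS (aeI mE (aeI uv uw)) => x [/= -> [uvx uwx]]; rewrite le_min uvx.
Qed.

Let L0_leUx u v w : (L0_join u v <= w) = (u <= w) && (v <= w).
Proof.
have mE := L0_classK (max_mfun (L0_fun u) (L0_fun v)).
apply/L0_leP/andP => [h|[/L0_leP uw /L0_leP vw]].
  by split; apply/L0_leP; apply: aeS (aeI h mE) => x [+ E];
    rewrite E ge_max => /andP[].
by apply: aeS (aeI mE (aeI uw vw)) => x [/= -> [uwx vwx]]; rewrite ge_max uwx.
Qed.

Let L0_leD2r w u v : u <= v -> u + w <= v + w.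
Proof.
move=> /L0_leP uv; apply/L0_leP.
apply: aeS (aeI uv (aeI (L0_addE u w) (L0_addE v w))) => x [/= uvx [-> ->]].
by rewrite lerD2r.
Qed.

Let L0_scaler_ge0 (a : R) u : 0 <= a -> 0 <= u -> 0 <= a *: u.
Proof.
move=> a0 /L0_leP u0; apply/L0_leP.
apply: aeS (aeI u0 (aeI (L0_classK 0) (L0_scaleE a u))) => x [ux [x0 ->]].
have E : L0_fun 0 x = 0 by exact: x0.
by move: ux; rewrite E => ux; exact: mulr_ge0.
Qed.

HB.instance Definition _ := POrderedLmodule_isRiesz.Build R L0
  L0_lexI L0_leUx L0_leD2r L0_scaler_ge0.

End L0.

(* Main.v *)
(* From right to left, the components of e (the p with p ⊓ (e - p) = 0) form a
   complete Boolean algebra, and the normalized functional is a strictly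
   positive, countably additive probability m on it.  Let X be its Stone space
   of ultrafilters and let hat p be the set of ultrafilters containing p.
   Declare a set null when it is covered by some hat p with m p arbitrarily
   small; the sets that differ from some hat p by a null set form a
   sigma-algebra, on which m induces a probability.  At an ultrafilter U the
   elements of E are totally preordered by "x <= y on some component in U", and
   the value of x at U is the real number t for which x is equivalent to t e;
   it exists off a null set and defines an injective lattice homomorphism into
   L0.  It is onto: lateral completeness realizes nonnegative countable step
   functions, and Dedekind completeness realizes limits of those.

   From left to right, e is the constant 1 and the functional is the integral.
   The completeness properties and the order continuity come from one fact: by
   maximizing the integral of sup_n atan u_n, every non-empty set A contains a
   sequence having no more upper bounds than A has. *)
Require Import Defs.
From HB Require Import structures.
From mathcomp Require Import all_boot all_order all_algebra.
From mathcomp Require Import all_classical all_reals all_analysis.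
From mathcomp Require Import lra measurable_realfun.

Set Implicit Arguments.
Unset Strict Implicit.
Unset Printing Implicit Defensive.

Import Order.TTheory GRing.Theory Num.Theory.
Import numFieldNormedType.Exports.

Local Open Scope classical_set_scope.
Local Open Scope ring_scope.

Local Notation "x ⊔ y" := (riesz_join x y) (at level 50, left associativity).
Local Notation "x ⊓ y" := (riesz_meet x y) (at level 48, left associativity).

(** * Riesz space arithmetic *)

Section RieszArithmetic.
Context {R : realType} {E : rieszType R}.
Implicit Types x y z a b p e : E.

Lemma riesz_leUl x y : x <= x ⊔ y.
Proof. by have := riesz_leUx x y (x ⊔ y); rewrite lexx => /esym/andP[]. Qed.

Lemma riesz_leUr x y : y <= x ⊔ y.
Proof. by have := riesz_leUx x y (x ⊔ y); rewrite lexx => /esym/andP[]. Qed.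

Lemma riesz_leIl x y : x ⊓ y <= x.
Proof. by have := riesz_lexI (x ⊓ y) x y; rewrite lexx => /esym/andP[]. Qed.

Lemma riesz_leIr x y : x ⊓ y <= y.
Proof. by have := riesz_lexI (x ⊓ y) x y; rewrite lexx => /esym/andP[]. Qed.

Lemma riesz_joinC x y : x ⊔ y = y ⊔ x.
Proof. by apply/le_anti; rewrite !riesz_leUx !riesz_leUl !riesz_leUr. Qed.

Lemma riesz_meetC x y : x ⊓ y = y ⊓ x.
Proof. by apply/le_anti; rewrite !riesz_lexI !riesz_leIl !riesz_leIr. Qed.

Lemma riesz_meet_l x y : x <= y -> x ⊓ y = x.
Proof. by move=> xy; apply/le_anti; rewrite riesz_leIl riesz_lexI lexx xy. Qed.

Lemma riesz_leU2 x y z t : x <= z -> y <= t -> x ⊔ y <= z ⊔ t.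
Proof.
move=> xz yt; rewrite riesz_leUx (le_trans xz (riesz_leUl _ _)).
exact: le_trans yt (riesz_leUr _ _).
Qed.

Lemma riesz_leI2 x y z t : x <= z -> y <= t -> x ⊓ y <= z ⊓ t.
Proof.
move=> xz yt; rewrite riesz_lexI (le_trans (riesz_leIl _ _) xz).
exact: le_trans (riesz_leIr _ _) yt.
Qed.

Lemma riesz_leBlDr x y z : (x - y <= z) = (x <= z + y).
Proof. by rewrite -(riesz_subr_ge0 (x - y)) opprB addrA riesz_subr_ge0. Qed.

Lemma riesz_leBrDr x y z : (x <= y - z) = (x + z <= y).
Proof. by rewrite -(riesz_subr_ge0 x) -addrA -opprD (addrC z) riesz_subr_ge0. Qed.

Lemma riesz_le0N x : (0 <= - x) = (x <= 0).
Proof. by rewrite -{1}oppr0 riesz_leN. Qed.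

Lemma riesz_leN0 x : (- x <= 0) = (0 <= x).
Proof. by rewrite -{1}oppr0 riesz_leN. Qed.

Lemma riesz_addr_ge0 x y : 0 <= x -> 0 <= y -> 0 <= x + y.
Proof. by move=> x0 y0; rewrite -[leLHS]addr0; exact: riesz_leD. Qed.

Lemma riesz_leDl x y : 0 <= y -> x <= x + y.
Proof. by move=> y0; rewrite -[leLHS]addr0; exact: riesz_leD. Qed.

Lemma riesz_geBl x y : 0 <= y -> x - y <= x.
Proof. by move=> y0; rewrite riesz_leBlDr riesz_leDl. Qed.

Lemma riesz_joinD x y z : (x ⊔ y) + z = (x + z) ⊔ (y + z).
Proof.
apply/le_anti/andP; split.
  by rewrite -riesz_leBrDr riesz_leUx !riesz_leBrDr riesz_leUl riesz_leUr.
by rewrite riesz_leUx !riesz_leD2r ?riesz_leUl ?riesz_leUr.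
Qed.

Lemma riesz_meetD x y z : (x ⊓ y) + z = (x + z) ⊓ (y + z).
Proof.
apply/le_anti/andP; split.
  by rewrite riesz_lexI !riesz_leD2r ?riesz_leIl ?riesz_leIr.
by rewrite -riesz_leBlDr riesz_lexI !riesz_leBlDr riesz_leIl riesz_leIr.
Qed.

Lemma riesz_oppU x y : - (x ⊔ y) = (- x) ⊓ (- y).
Proof.
apply/le_anti/andP; split.
  by rewrite riesz_lexI !riesz_leN riesz_leUl riesz_leUr.
rewrite -riesz_leN opprK riesz_leUx -(riesz_leN _ x) -(riesz_leN _ y) !opprK.
by rewrite riesz_leIl riesz_leIr.
Qed.

Lemma riesz_oppI x y : - (x ⊓ y) = (- x) ⊔ (- y).
Proof. by rewrite -[RHS]opprK riesz_oppU !opprK. Qed.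

Lemma riesz_addUI x y : x + y = (x ⊔ y) + (x ⊓ y).
Proof.
apply/eqP; rewrite -subr_eq riesz_oppI; apply/eqP.
by rewrite addrC riesz_joinD addKr [x + y]addrC addKr riesz_joinC.
Qed.

Definition riesz_pos x : E := x ⊔ 0.

Lemma riesz_pos_ge0 x : 0 <= riesz_pos x.
Proof. exact: riesz_leUr. Qed.

Lemma riesz_le_pos x : x <= riesz_pos x.
Proof. exact: riesz_leUl. Qed.

Lemma riesz_pos_le0 x : (riesz_pos x <= 0) = (x <= 0).
Proof. by rewrite /riesz_pos riesz_leUx lexx andbT. Qed.

Lemma riesz_leP x y : x <= y -> riesz_pos x <= riesz_pos y.
Proof. by move=> xy; exact: riesz_leU2. Qed.

Lemma riesz_posD x y : riesz_pos (x + y) <= riesz_pos x + riesz_pos y.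
Proof.
rewrite {1}/riesz_pos riesz_leUx riesz_leD ?riesz_le_pos//=.
by rewrite riesz_addr_ge0 ?riesz_pos_ge0.
Qed.

Lemma riesz_posB x : x = riesz_pos x - riesz_pos (- x).
Proof.
rewrite -[LHS]addr0 (riesz_addUI x 0); congr (_ + _).
by rewrite /riesz_pos riesz_oppU opprK oppr0.
Qed.

(** Both factors are translates by [riesz_pos (- x)], of [x] and of [0], and [x ⊓ 0] is the opposite
    of [riesz_pos (- x)]. *)
Lemma riesz_pos_meet x : riesz_pos x ⊓ riesz_pos (- x) = 0.
Proof.
have {1}-> : riesz_pos x = x + riesz_pos (- x) by rewrite {2}[x]riesz_posB subrK.
rewrite -{2}[riesz_pos (- x)]add0r -riesz_meetD /riesz_pos.
by rewrite -[X in _ + (_ ⊔ X)]oppr0 -riesz_oppI subrr.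
Qed.

(** Disjointness of nonnegative elements is written [a ⊓ b <= 0]: unlike equality with [0], the
    inequality passes to smaller elements whatever their sign. *)
Lemma riesz_meet_le0S a b a' b' :
  a <= a' -> b <= b' -> a' ⊓ b' <= 0 -> a ⊓ b <= 0.
Proof. by move=> aa bb; apply: le_trans; exact: riesz_leI2. Qed.

(** Translation turns the right side into the meet of [p + p ⊓ b], which is at least [p], and
    [a + p ⊓ b], which equals [(p + a) ⊓ (a + b)]. *)
Lemma riesz_meetD_le p a b : 0 <= p -> 0 <= a -> 0 <= b ->
  p ⊓ (a + b) <= p ⊓ a + p ⊓ b.
Proof.
move=> p0 a0 b0; rewrite riesz_meetD riesz_lexI; apply/andP; split.
  rewrite (le_trans (riesz_leIl _ _))// riesz_leDl// riesz_lexI p0; exact: b0.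
have -> : a + p ⊓ b = (p + a) ⊓ (a + b).
  by rewrite addrC riesz_meetD [b + a]addrC.
by rewrite riesz_leI2// riesz_leDl.
Qed.

Lemma riesz_meet_le0D p a b : 0 <= p -> 0 <= a -> 0 <= b ->
  p ⊓ a <= 0 -> p ⊓ b <= 0 -> p ⊓ (a + b) <= 0.
Proof.
move=> p0 a0 b0 pa pb; apply: le_trans (riesz_meetD_le p0 a0 b0) _.
by rewrite -[leRHS]addr0 riesz_leD.
Qed.

Lemma riesz_meetZ (c : R) x y : 0 < c -> c *: (x ⊓ y) = (c *: x) ⊓ (c *: y).
Proof.
move=> c0; have cV0 : 0 <= c^-1 by rewrite invr_ge0 ltW.
have cK : c * c^-1 = 1 by rewrite divff ?gt_eqF.
apply/le_anti; rewrite riesz_lexI !riesz_leZ ?(ltW c0) ?riesz_leIl ?riesz_leIr//=.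
have -> : (c *: x) ⊓ (c *: y) = c *: (c^-1 *: ((c *: x) ⊓ (c *: y))).
  by rewrite scalerA cK scale1r.
apply: riesz_leZ; first exact: ltW.
by rewrite riesz_lexI; apply/andP; split;
  [rewrite -[leRHS]scale1r -[in leRHS]cK|rewrite -[leRHS]scale1r -[in leRHS]cK];
  rewrite [c * _]mulrC -scalerA; apply: riesz_leZ => //;
  rewrite ?riesz_leIl ?riesz_leIr.
Qed.

Lemma riesz_meet_le0Z p a (c : R) : 0 <= p -> 0 <= a -> 0 <= c ->
  p ⊓ a <= 0 -> p ⊓ (c *: a) <= 0.
Proof.
(* Both elements are enlarged to multiples by [c + 1], which is positive even when [c = 0] and is at
   least [1] and at least [c]. *)
move=> p0 a0 c0 pa; have c1 : 0 < c + 1 by rewrite ltr_wpDl.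
apply: (@riesz_meet_le0S _ _ ((c + 1) *: p) ((c + 1) *: a)).
- by rewrite scalerDl scale1r addrC riesz_leDl// riesz_scaler_ge0.
- by rewrite scalerDl scale1r riesz_leDl.
- by rewrite -riesz_meetZ// -[leRHS](scaler0 _ (c + 1)) riesz_leZ// ltW.
Qed.

(** Addition replaces infinite distributivity: [a + b = a ⊔ b + a ⊓ b <= s ⊔ b] for every [a] in
    [A], so [s + b <= s ⊔ b], which means [s ⊓ b <= 0]. *)
Lemma riesz_isLub_meet_le0 (A : set E) s b : isLub A s ->
  (forall a, A a -> a ⊓ b <= 0) -> s ⊓ b <= 0.
Proof.
move=> [As sA] Ab.
have : s <= (s ⊔ b) - b.
  apply: sA => a Aa; rewrite riesz_leBrDr riesz_addUI.
  rewrite -[leRHS]addr0; apply: riesz_leD; last exact: Ab.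
  by apply: riesz_leU2 => //; exact: As.
by rewrite riesz_leBrDr riesz_addUI addrC -riesz_leBrDr subrr.
Qed.

Lemma riesz_isLub_uniq (A : set E) s t : isLub A s -> isLub A t -> s = t.
Proof.
by move=> [As sA] [At tA]; apply/le_anti; rewrite sA//= tA.
Qed.

Lemma riesz_isLub_ge0 (A : set E) s : (exists2 a, A a & 0 <= a) ->
  isLub A s -> 0 <= s.
Proof. by move=> [a Aa a0] [As _]; exact: le_trans (As _ Aa). Qed.

Lemma riesz_abs_ge x : x <= riesz_abs x.
Proof. exact: riesz_leUl. Qed.

Lemma riesz_abs_geN x : - x <= riesz_abs x.
Proof. exact: riesz_leUr. Qed.

Lemma riesz_ge0_half x : 0 <= x + x -> 0 <= x.
Proof.
move=> xx; have h : 0 <= (2^-1 : R) by rewrite invr_ge0.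
have -> : x = (2^-1 : R) *: (x + x).
  by rewrite -(mulr2n x) -[x *+ 2]scaler_nat scalerA mulVf ?pnatr_eq0// scale1r.
exact: riesz_scaler_ge0.
Qed.

Lemma riesz_abs_ge0 x : 0 <= riesz_abs x.
Proof.
apply: riesz_ge0_half.
by rewrite -[leLHS](subrr x) riesz_leD ?riesz_abs_ge ?riesz_abs_geN.
Qed.

Lemma riesz_ge0_abs x : 0 <= x -> riesz_abs x = x.
Proof.
move=> x0; apply/le_anti; rewrite riesz_abs_ge andbT riesz_leUx lexx/=.
by rewrite (le_trans _ x0)// riesz_leN0.
Qed.

End RieszArithmetic.

(** * Components and their Stone space *)

Section Components.
Context {R : realType} {E : rieszType R}.
Hypothesis E_dc : dedekind_complete E.
Variable e : E.
Hypothesis e_ge0 : 0 <= e.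
Implicit Types p q r x y z : E.

Definition component p := [/\ 0 <= p, p <= e & p ⊓ (e - p) <= 0].

Lemma component0 : component 0.
Proof. by split=> //; exact: riesz_leIl. Qed.

Lemma componentC p : component p -> component (e - p).
Proof.
move=> [p0 pe pp]; split; first by rewrite riesz_subr_ge0.
  exact: riesz_geBl.
by rewrite subKr riesz_meetC.
Qed.

Lemma component_unit : component e.
Proof. by rewrite -[e]subr0; apply: componentC; exact: component0. Qed.

Lemma componentI p q : component p -> component q -> component (p ⊓ q).
Proof.
move=> [p0 pe pp] [q0 qe qq]; split; first by rewrite riesz_lexI p0.
  exact: le_trans (riesz_leIl _ _) pe.
have ep : 0 <= e - p by rewrite riesz_subr_ge0.
have eq : 0 <= e - q by rewrite riesz_subr_ge0.
apply: (@riesz_meet_le0S _ _ _ _ (p ⊓ q) ((e - p) + (e - q))) => //.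
  have -> : e - p ⊓ q = (e - p) ⊔ (e - q).
    by rewrite riesz_oppI ![e + _]addrC riesz_joinD.
  by rewrite riesz_leUx riesz_leDl//= [leRHS]addrC riesz_leDl.
apply: riesz_meet_le0D => //; first by rewrite riesz_lexI p0.
  by apply: riesz_meet_le0S pp => //; exact: riesz_leIl.
by apply: riesz_meet_le0S qq => //; exact: riesz_leIr.
Qed.

Lemma componentU p q : component p -> component q -> component (p ⊔ q).
Proof.
move=> cp cq; have -> : p ⊔ q = e - ((e - p) ⊓ (e - q)).
  by rewrite riesz_oppI !opprB [RHS]addrC riesz_joinD !subrK.
by apply/componentC/componentI; exact: componentC.
Qed.

(** Since [p <= (e - q) + q], subadditivity of the meet bounds [p] by [p ⊓ (e - q) + p ⊓ q].
    Comparing components thus reduces to a disjointness. *)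
Lemma component_le p q : component p -> component q ->
  p ⊓ (e - q) <= 0 -> p <= q.
Proof.
move=> [p0 pe _] [q0 qe _] pq; have eq : 0 <= e - q by rewrite riesz_subr_ge0.
rewrite -(riesz_meet_l pe) -[X in _ ⊓ X](subrK q).
apply: le_trans (riesz_meetD_le p0 eq q0) _.
by rewrite -[leRHS]add0r riesz_leD// riesz_leIr.
Qed.

Lemma component_sup (A : set E) s : A !=set0 -> (forall p, A p -> component p) ->
  isLub A s -> component s.
Proof.
move=> [a Aa] Ac As; split.
- by have [a0 _ _] := Ac _ Aa; apply: riesz_isLub_ge0 As; exists a.
- by case: As => _; apply => p /Ac[].
- apply: (riesz_isLub_meet_le0 As) => p Ap; have [_ _] := Ac _ Ap.
  apply: riesz_meet_le0S => //; apply: riesz_leD => //; rewrite riesz_leN.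
  by case: As => + _; exact.
Qed.

Lemma component_seq_sup (p : nat -> E) : (forall n, component (p n)) ->
  exists2 s, isLub (range p) s & component s.
Proof.
move=> cp; have [s ps] : exists s, isLub (range p) s.
  apply: E_dc; split; first by exists (p 0%N), 0%N.
  by exists e => _ [n _ <-]; case: (cp n).
exists s => //; apply: component_sup ps; first by exists (p 0%N), 0%N.
by move=> _ [n _ <-].
Qed.

(** [q] is the supremum of the elements between [0] and [e] that are disjoint from [a]. A
    nonnegative element below [e - q] and disjoint from [a] could be added to [q], so it vanishes;
    this gives the last clause and, applied to [q ⊓ (e - q)], makes [q] a component. *)
Lemma component_polar a : 0 <= a -> exists q,
  [/\ component q, q ⊓ a <= 0 & forall w, 0 <= w -> w ⊓ a <= 0 ->
    (e - q) ⊓ w <= 0].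
Proof.
move=> a0; pose A := [set y | [/\ 0 <= y, y <= e & y ⊓ a <= 0]].
have [q Aq] : exists q, isLub A q.
  apply: E_dc; split; last by exists e => y [].
  by exists 0; split=> //; exact: riesz_leIl.
have q0 : 0 <= q.
  by apply: riesz_isLub_ge0 Aq; exists 0 => //; split=> //; exact: riesz_leIl.
have qe : q <= e by case: Aq => _; apply => y [].
have qa : q ⊓ a <= 0 by apply: riesz_isLub_meet_le0 Aq _ => y [].
have qw w : 0 <= w -> w ⊓ a <= 0 -> w <= e - q -> w <= 0.
  move=> w0 wa wq; suff : w + q <= q by rewrite -riesz_leBrDr subrr.
  have [+ _] := Aq; apply; split; first exact: riesz_addr_ge0.
    by rewrite -riesz_leBrDr.
  by rewrite riesz_meetC; apply: riesz_meet_le0D; rewrite // riesz_meetC.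
have eq : 0 <= e - q by rewrite riesz_subr_ge0.
exists q; split=> //; last first.
  move=> w w0 wa; apply: qw; first by rewrite riesz_lexI eq.
    by apply: riesz_meet_le0S wa => //; exact: riesz_leIr.
  exact: riesz_leIl.
split=> //; apply: qw; first by rewrite riesz_lexI q0.
  by apply: riesz_meet_le0S qa => //; exact: riesz_leIl.
exact: riesz_leIr.
Qed.

(** [q] is the part of [e] where [z <= 0], and [e - q] the part where [z >= 0]. The polar of
    [riesz_pos z] gives both, because the negative part of [z] is disjoint from the positive one. *)
Lemma component_sign z : exists q, [/\ component q, q ⊓ riesz_pos z <= 0
  & (e - q) ⊓ riesz_pos (- z) <= 0].
Proof.
have [q [cq qz qw]] := component_polar (riesz_pos_ge0 z).
exists q; split=> //; apply: qw; first exact: riesz_pos_ge0.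
by rewrite riesz_meetC riesz_pos_meet.
Qed.

Fixpoint join_seq (p : nat -> E) n : E :=
  if n is m.+1 then join_seq p m ⊔ p n else p 0%N.

Lemma join_seq_component (p : nat -> E) : (forall n, component (p n)) ->
  forall n, component (join_seq p n).
Proof. by move=> cp; elim=> //= n IH; exact: componentU. Qed.

Lemma join_seqS (p : nat -> E) n : join_seq p n <= join_seq p n.+1.
Proof. exact: riesz_leUl. Qed.

Lemma le_join_seq (p : nat -> E) m n : (m <= n)%N ->
  join_seq p m <= join_seq p n.
Proof.
elim: n => [|n IH]; first by rewrite leqn0 => /eqP ->.
rewrite leq_eqVlt => /predU1P[->//|/IH h]; exact: le_trans h (join_seqS p n).
Qed.

Lemma join_seq_ge (p : nat -> E) n : p n <= join_seq p n.
Proof. by case: n => //= n; exact: riesz_leUr. Qed.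

Lemma join_seq_le (p : nat -> E) s : (forall n, p n <= s) ->
  forall n, join_seq p n <= s.
Proof. by move=> ps; elim=> //= n IH; rewrite riesz_leUx IH ps. Qed.

Lemma join_seq_isLub (p : nat -> E) s :
  isLub (range p) s -> isLub (range (join_seq p)) s.
Proof.
move=> [ps sp]; split.
  by move=> _ [n _ <-]; apply: join_seq_le => k; apply: ps; exists k.
move=> b pb; apply: sp => _ [n _ <-]; apply: le_trans (join_seq_ge p n) _.
by apply: pb; exists n.
Qed.

End Components.

(** * The Stone space of the algebra of components *)

Section StoneSpace.
Context {R : realType} {E : rieszType R}.
Hypothesis E_dc : dedekind_complete E.
Variable e : E.
Hypothesis e_ge0 : 0 <= e.
Implicit Types (p q r x y z : E) (U : set_system E).

(** Leaving out the zero component makes [components_below 0] empty, so that no proper filter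
    contains it. *)
Definition components_below p : set E := [set q | [/\ component e q, 0 < q & q <= p]].

(* An ultrafilter of the algebra of components is encoded as a filter on E; the
   set systems that are not of this form will be null. *)
Definition stone_point U := Filter U /\ ~ U set0 /\
  forall p, component e p ->
    U (components_below p) \/ U (components_below (e - p)).

Definition stone_set p : set (set_system E) :=
  [set U | stone_point U /\ U (components_below p)].

Lemma stone_set0 U : ~ stone_set 0 U.
Proof.
move=> [[FU [U0 _]]]; suff -> : components_below 0 = set0 by [].
rewrite -subset0 => q [_ q0 q0']; have := lt_le_trans q0 q0'.
by rewrite ltxx.
Qed.

Lemma stone_setS p q : p <= q -> stone_set p `<=` stone_set q.
Proof.
move=> pq U [sU Up]; split=> //; have [FU _] := sU.
by apply: filterS Up => r [cr r0 rp]; split=> //; exact: le_trans pq.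
Qed.

Lemma stone_setI p q : stone_set (p ⊓ q) = stone_set p `&` stone_set q.
Proof.
apply/seteqP; split.
  move=> U Upq; split; apply: stone_setS Upq.
    exact: riesz_leIl.
  exact: riesz_leIr.
move=> U [[sU Up] [_ Uq]]; split=> //; have [FU _] := sU.
apply: filterS (filterI Up Uq) => r [[cr r0 rp] [_ _ rq]]; split=> //.
by rewrite riesz_lexI rp.
Qed.

Lemma stone_setC p U : component e p -> stone_point U ->
  stone_set (e - p) U <-> ~ stone_set p U.
Proof.
move=> cp sU; split.
  move=> Up Up'; have : stone_set (p ⊓ (e - p)) U by rewrite stone_setI.
  by case: cp => _ _ /stone_setS h /h; exact: stone_set0.
have [_ [_ /(_ _ cp)[Up []|]]] := sU; last by split.
by split.
Qed.

(* The sets containing a dense set of components below p form a filter; an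
   ultrafilter above it decides every component. *)
Lemma stone_set_neq0 p : component e p -> ~~ (p <= 0) -> stone_set p !=set0.
Proof.
move=> cp p0.
have pos r : component e r -> ~~ (r <= 0) -> 0 < r.
  by move=> [r0 _ _] rn0; rewrite lt_neqAle r0 andbT; apply: contraNneq rn0 => <-.
pose F := [set S : set E | forall q, component e q -> 0 < q -> q <= p ->
  exists r, [/\ component e r, 0 < r, r <= q &
    forall s, component e s -> 0 < s -> s <= r -> S s]].
have FF : ProperFilter F.
  apply: Build_ProperFilter_ex.
    move=> S /(_ p cp (pos _ cp p0) (lexx _))[r [cr r0 _ Sr]].
    by exists r; exact: Sr.
  split=> [q cq q0 qp|S T FS FT q cq q0 qp|S T ST FS q cq q0 qp].
  - by exists q.
  - have [r [cr r0 rq Sr]] := FS _ cq q0 qp.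
    have [t [ct t0 tr Tt]] := FT _ cr r0 (le_trans rq qp).
    exists t; split=> //; first exact: le_trans rq.
    move=> s cs s0 st; split; last exact: Tt.
    by apply: Sr => //; exact: le_trans tr.
  - have [r [cr r0 rq Sr]] := FS _ cq q0 qp.
    by exists r; split=> // s cs s0 sr; exact/ST/Sr.
have [U [UU FU]] := ultraFilterLemma FF.
have PU : ProperFilter U by exact: ultra_proper.
exists U; split; last first.
  by apply: FU => q cq q0 qp; exists q; split=> // s cs s0 sq; split=> //;
    exact: le_trans qp.
split; first exact: filter_filter; split; first exact: filter_not_empty.
move=> q cq; have [|nUq] := pselect (U (components_below q)); first by left.
right; have [|Uq] := in_ultra_setVsetC (components_below q) UU; first by [].
(* Below a nonzero [r], either [r ⊓ q] is a nonzero component below [q], or all of [r] lies below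
   [e - q]; hence the union belongs to [F]. *)
have UD : U (components_below q `|` components_below (e - q)).
  apply: FU => r cr r0 rp; have [rq|rq] := boolP (r ⊓ q <= 0).
    exists r; split=> // s cs s0 sr; right; split=> //.
    apply: (component_le cs (componentC cq)); rewrite subKr.
    by apply: riesz_meet_le0S rq.
  exists (r ⊓ q); split; first exact: componentI.
  - by apply: pos => //; exact: componentI.
  - exact: riesz_leIl.
  - move=> s cs s0 sr; left; split=> //; apply: le_trans sr _.
    exact: riesz_leIr.
by apply: filterS (filterI UD Uq) => r [[]].
Qed.

(** If [p ⊓ (e - q)] were nonzero, an ultrafilter containing it would lie in the Stone set of [p]
    and outside that of [q]. *)
Lemma stone_set_le p q : component e p -> component e q ->
  stone_set p `<=` stone_set q -> p <= q.
Proof.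
move=> cp cq pq; apply: (component_le cp cq); apply: contrapT => /negP pq0.
have [U] := stone_set_neq0 (componentI cp (componentC cq)) pq0.
rewrite stone_setI => -[Up Uq]; have [sU _] := Up.
by have /stone_setC := Uq; apply => //; exact: pq.
Qed.

End StoneSpace.

(** * The measure on the Stone space *)

(** The fourth field is strict positivity; the last, continuity along sequences decreasing to [0],
    carries the countable additivity. *)
Record component_probability (R : realType) (E : rieszType R) (e : E)
    (m : E -> R) : Prop := ComponentProbability {
  component_probability_ge0 : forall p, component e p -> 0 <= m p;
  component_probability_unit : m e = 1;
  component_probabilityD : forall p q, component e p -> component e q ->
    p ⊓ q <= 0 -> m (p + q) = m p + m q;
  component_probability_eq0 : forall p, component e p -> m p = 0 -> p <= 0;
  component_probability_cvg0 : forall p : nat -> E,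
    (forall n, component e (p n)) -> (forall n, p n.+1 <= p n) ->
    (forall z, (forall n, z <= p n) -> z <= 0) ->
    forall eps : R, 0 < eps -> exists n, m (p n) < eps
}.

Section StoneMeasure.
Context {R : realType} {E : rieszType R}.
Hypothesis E_dc : dedekind_complete E.
Variable e : E.
Hypothesis e_ge0 : 0 <= e.
Variable m : E -> R.
Hypothesis m_prob : component_probability e m.
Implicit Types (p q r x y z : E) (U : set_system E) (A : set (set_system E)).

Local Notation comp := (component e).
Local Notation S := (stone_set e).

Let m_ge0 := component_probability_ge0 m_prob.
Let m_unit := component_probability_unit m_prob.
Let m_add := component_probabilityD m_prob.
Let m_eq0 := component_probability_eq0 m_prob.
Let m_cvg0 := component_probability_cvg0 m_prob.

Lemma component_disjointE p q : comp p -> comp q -> p ⊓ q <= 0 ->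
  p ⊔ q = p + q.
Proof.
move=> [p0 _ _] [q0 _ _] pq; rewrite riesz_addUI.
have -> : p ⊓ q = 0 by apply/le_anti; rewrite pq riesz_lexI p0.
by rewrite addr0.
Qed.

Lemma componentDl p q : comp p -> comp q -> p ⊔ q = p + q ⊓ (e - p).
Proof.
move=> cp cq; have cpq : comp (q ⊓ (e - p)).
  by apply: componentI => //; exact: componentC.
have [p0 pe pp] := cp; have [q0 qe qq] := cq.
have d : p ⊓ (q ⊓ (e - p)) <= 0 by apply: riesz_meet_le0S pp => //; exact: riesz_leIr.
rewrite -component_disjointE//; apply/le_anti/andP; split.
  (* Writing [q] as [q ⊓ (p + (e - p))], subadditivity of the meet gives [q <= p + q ⊓ (e - p)]. *)
  rewrite riesz_leUx riesz_leUl/= component_disjointE// -{1}(riesz_meet_l qe).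
  have {1}-> : e = p + (e - p) by rewrite addrC subrK.
  apply: le_trans (riesz_meetD_le q0 p0 _) _; first by rewrite riesz_subr_ge0.
  by rewrite riesz_leD2r// riesz_leIr.
by rewrite riesz_leU2// riesz_leIl.
Qed.

Lemma stone_mass0 : m 0 = 0.
Proof.
have c0 := component0 e_ge0; have := m_add c0 c0 (riesz_leIl _ _).
by rewrite addr0 => /eqP; rewrite -subr_eq subrr eq_sym => /eqP.
Qed.

Lemma stone_massU p q : comp p -> comp q -> m (p ⊔ q) = m p + m (q ⊓ (e - p)).
Proof.
move=> cp cq; rewrite componentDl// m_add//.
  by apply: componentI => //; exact: componentC.
by have [_ _] := cp; apply: riesz_meet_le0S => //; exact: riesz_leIr.
Qed.

Lemma stone_massD p q : comp p -> comp q -> p <= q ->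
  m q = m p + m (q ⊓ (e - p)).
Proof.
move=> cp cq pq; rewrite -stone_massU//; congr m.
by apply/le_anti; rewrite riesz_leUr riesz_leUx pq/= lexx.
Qed.

Lemma le_stone_mass p q : comp p -> comp q -> p <= q -> m p <= m q.
Proof.
move=> cp cq pq; rewrite (stone_massD cp cq pq) lerDl m_ge0//.
by apply: componentI => //; exact: componentC.
Qed.

Lemma stone_massU_le p q : comp p -> comp q -> m (p ⊔ q) <= m p + m q.
Proof.
move=> cp cq; rewrite stone_massU// lerD2l le_stone_mass ?riesz_leIl//.
by apply: componentI => //; exact: componentC.
Qed.

(** The remainders [s ⊓ (e - join_seq p n)] decrease to [0]: the positive part of a common lower
    bound is disjoint from every [join_seq p n], hence from their supremum [s], and yet lies below
    [s]. *)
Lemma stone_mass_join_seq (p : nat -> E) s eps : (forall n, comp (p n)) ->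
  isLub (range p) s -> 0 < eps ->
  exists n, m (s ⊓ (e - join_seq p n)) < eps.
Proof.
move=> cp ps eps0; have cs : comp s.
  by apply: (component_sup _ _ ps); [exists (p 0%N), 0%N|move=> _ [n _ <-]].
apply: (m_cvg0 (p := fun n => s ⊓ (e - join_seq p n))) => //.
- move=> n; apply: componentI => //; apply: componentC => //.
  exact: join_seq_component.
- by move=> n; rewrite riesz_leI2// riesz_leD// riesz_leN join_seqS.
move=> z zp; rewrite -riesz_pos_le0.
have [s0 _ _] := cs.
have zs : riesz_pos z <= s.
  by rewrite riesz_leUx s0 (le_trans (zp 0%N))// riesz_leIl.
suff : s ⊓ riesz_pos z <= 0 by rewrite riesz_meetC riesz_meet_l.
apply: (riesz_isLub_meet_le0 (join_seq_isLub ps)) => _ [n _ <-].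
have [_ pe pp] := join_seq_component cp n.
apply: riesz_meet_le0S pp => //.
by rewrite riesz_leUx riesz_subr_ge0 pe (le_trans (zp n))// riesz_leIr.
Qed.

Definition stone_null A := forall eps, 0 < eps ->
  exists p, [/\ comp p, A `&` stone_point e `<=` S p & m p < eps].

Lemma stone_nullS A B : A `<=` B -> stone_null B -> stone_null A.
Proof.
move=> AB nB eps /nB[p [cp Bp mp]]; exists p; split=> //.
by move=> U [/AB ? ?]; exact: Bp.
Qed.

Lemma stone_null0 : stone_null set0.
Proof.
move=> eps eps0; exists 0; split; first exact: component0.
  by move=> U [].
by rewrite stone_mass0.
Qed.

Lemma stone_null_bigcup (F : nat -> set (set_system E)) :
  (forall n, stone_null (F n)) -> stone_null (\bigcup_n F n).
Proof.
move=> nF eps eps0.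
(* These bounds add up to [eps / 2]; the other half pays for what the supremum [s] of all the covers
   has beyond a finite join. *)
have e2 n : 0 < eps / 2 ^+ n.+2 by rewrite divr_gt0// exprn_gt0.
have /choice[p pP] := fun n => nF n _ (e2 n).
have cp n : comp (p n) by case: (pP n).
have [s ps cs] := component_seq_sup E_dc cp.
exists s; split=> //.
  move=> U [[n _ FU] sU]; apply: (@stone_setS _ _ e (p n)).
    by case: ps => + _; apply; exists n.
  by case: (pP n) => _ + _; exact.
have half n : eps / 2 ^+ n = eps / 2 ^+ n.+1 + eps / 2 ^+ n.+1.
  by rewrite exprSr invfM mulrA -splitr.
have mJ n : m (join_seq p n) <= eps / 2 - eps / 2 ^+ n.+2.
  have h1 := half 1%N; rewrite expr1 in h1.
  elim: n => [|n IH] /=; first by case: (pP 0%N) => _ _; lra.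
  have cJ := join_seq_component cp n.
  apply: le_trans (stone_massU_le cJ (cp _)) _.
  case: (pP n.+1) => _ _ h; have := half n.+2; lra.
have [n] := stone_mass_join_seq cp ps (divr_gt0 eps0 (ltr0Sn R 1)).
have cJ := join_seq_component cp n.
have Js : join_seq p n <= s by apply: join_seq_le => k; case: ps => + _; apply; exists k.
rewrite (stone_massD cJ cs Js) => h.
rewrite [ltRHS]splitr; apply: ler_ltD => //.
by apply: le_trans (mJ n) _; rewrite gerBl ltW.
Qed.

Lemma stone_nullU A B : stone_null A -> stone_null B -> stone_null (A `|` B).
Proof.
move=> nA nB; rewrite -bigcup2E; apply: stone_null_bigcup => -[|[|n]]//=.
exact: stone_null0.
Qed.

(** A cover of [S p] by [S q] forces [p <= q], so [m p] is below every [eps], and strict positivity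
    of [m] concludes. *)
Lemma stone_null_set p : comp p -> stone_null (S p) -> p <= 0.
Proof.
move=> cp np; apply: m_eq0 => //; apply/eqP; rewrite eq_le m_ge0// andbT.
apply/ler_addgt0Pr => eps /np[q [cq pq mq]]; rewrite add0r.
apply: le_trans (ltW mq); apply: le_stone_mass => //.
apply: (stone_set_le cp cq) => // U pU; apply: pq; split=> //.
by case: pU.
Qed.

Lemma stone_setU p q : comp p -> comp q -> S (p ⊔ q) = S p `|` S q.
Proof.
move=> cp cq; apply/seteqP; split=> U; last first.
  case; apply: stone_setS; [exact: riesz_leUl|exact: riesz_leUr].
move=> UU; have [sU _] := UU; apply: contrapT => /not_orP[Up Uq].
have : stone_set e (e - (p ⊔ q)) U.
  have -> : e - (p ⊔ q) = (e - p) ⊓ (e - q).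
    by rewrite riesz_oppU ![e + _]addrC riesz_meetD.
  by rewrite stone_setI; split; apply/stone_setC.
by move/stone_setC; apply=> //; exact: componentU.
Qed.

Lemma stone_set_join_seq (p : nat -> E) n : (forall n, comp (p n)) ->
  S (join_seq p n) `<=` \bigcup_k S (p k).
Proof.
move=> cp; elim: n => [|n IH] /=; first by move=> U Up; exists 0%N.
rewrite stone_setU//; last exact: join_seq_component.
by rewrite subUset; split=> // U Up; exists n.+1.
Qed.

(** * The sigma-algebra of sets equal to some [S p] up to a null set, and its measure *)

Definition stone_approx A p :=
  comp p /\ stone_null ((A `\` S p) `|` (S p `\` A)).

Definition stone_sigma : set (set (set_system E)) :=
  [set A | exists p, stone_approx A p].

(** A point of [S p] outside [S q] lies in one of the two error sets, so [p ⊓ (e - q)] has a null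
    Stone set and is zero. With [A = B] this makes the approximating component unique. *)
Lemma stone_approx_le A B p q : A `<=` B -> stone_approx A p ->
  stone_approx B q -> p <= q.
Proof.
move=> AB [cp Ap] [cq Bq]; apply: (component_le cp cq).
have cpq : comp (p ⊓ (e - q)) by apply: componentI => //; exact: componentC.
apply: stone_null_set => //; apply: stone_nullS (stone_nullU Ap Bq).
rewrite stone_setI => U [Up Uq]; have [sU _] := Up.
have {}Uq : ~ S q U by apply/stone_setC.
have [AU|AU] := pselect (A U); last by left; right.
by right; left; split=> //; exact: AB.
Qed.

Lemma stone_approx_disjoint A B p q : stone_approx A p -> stone_approx B q ->
  A `&` B = set0 -> p ⊓ q <= 0.
Proof.
move=> [cp Ap] [cq Bq] AB; apply: stone_null_set; first exact: componentI.
apply: stone_nullS (stone_nullU Ap Bq).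
rewrite stone_setI => U [Up Uq].
have [AU|AU] := pselect (A U); last by left; right.
by right; right; split=> // BU; rewrite -[False]/(set0 U) -AB.
Qed.

Lemma stone_approx_uniq A p q : stone_approx A p -> stone_approx A q -> p = q.
Proof.
move=> Ap Aq; apply/le_anti.
by rewrite (stone_approx_le _ Ap Aq)// (stone_approx_le _ Aq Ap).
Qed.

Lemma stone_approx_set p : comp p -> stone_approx (S p) p.
Proof. by move=> cp; split=> //; rewrite setDv setU0; exact: stone_null0. Qed.

Lemma stone_approx_null A : stone_null A -> stone_approx A 0.
Proof.
move=> nA; split; first exact: component0.
apply: stone_nullS nA => U [[]//|[/(@stone_set0 _ _ e)]].
by [].
Qed.

Lemma stone_approx_eqnull A B p : stone_approx A p ->
  stone_null ((A `\` B) `|` (B `\` A)) -> stone_approx B p.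
Proof.
move=> [cp Ap] AB; split=> //; apply: stone_nullS (stone_nullU Ap AB).
move=> U; have [AU|AU] := pselect (A U); case=> -[h1 h2].
- by left; left.
- by right; left.
- by right; right.
- by left; right.
Qed.

Lemma stone_approxC A p : stone_approx A p -> stone_approx (~` A) (e - p).
Proof.
move=> [cp Ap]; split; first exact: componentC.
move=> eps /Ap[q [cq Aq mq]]; exists q; split=> // U [AU sU]; apply: Aq; split=> //.
move: AU; have CU := stone_setC cp sU; case=> -[h1 h2].
  by right; split=> //; apply: contrapT => /CU.
by left; split; [exact: contrapT|apply/CU].
Qed.

(** [S s] can be larger than the union of the [S (p n)], but the excess lies in
    [S (s ⊓ (e - join_seq p n))] for every [n], and these have arbitrarily small mass. *)
Lemma stone_approx_bigcup (F : nat -> set (set_system E)) (p : nat -> E) s :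
  (forall n, stone_approx (F n) (p n)) -> isLub (range p) s ->
  stone_approx (\bigcup_n F n) s.
Proof.
move=> Fp ps; have cp n : comp (p n) by case: (Fp n).
have cs : comp s.
  by apply: (component_sup _ _ ps); [exists (p 0%N), 0%N|move=> _ [n _ <-]].
split=> //.
have nS : stone_null (S s `\` \bigcup_n S (p n)).
  move=> eps eps0; have [n mn] := stone_mass_join_seq cp ps eps0.
  have cJ := join_seq_component cp n.
  exists (s ⊓ (e - join_seq p n)); split=> //.
    by apply: componentI => //; exact: componentC.
  move=> U [[sU nU] spU]; rewrite stone_setI; split=> //.
  by apply/stone_setC => // /(stone_set_join_seq cp).
apply: stone_nullS (stone_nullU (stone_null_bigcup (fun n => (Fp n).2)) nS).
move=> U [[[n _ FU] nU]|[sU nU]].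
  left; exists n => //; left; split=> //; apply: contra_not nU.
  by apply: stone_setS; case: ps => + _; apply; exists n.
have [[n _ pU]|npU] := pselect ((\bigcup_n S (p n)) U); last by right.
by left; exists n => //; right; split=> //; apply: contra_not nU => FU; exists n.
Qed.

Lemma stone_sigma_algebra : sigma_algebra setT stone_sigma.
Proof.
split.
- by exists 0; apply: stone_approx_null; exact: stone_null0.
- by move=> A [p Ap]; exists (e - p); rewrite setTD; exact: stone_approxC.
- move=> F /choice[p Fp]; have cp n : comp (p n) by case: (Fp n).
  have [s ps _] := component_seq_sup E_dc cp.
  by exists s; exact: stone_approx_bigcup ps.
Qed.

(** Sets outside the sigma-algebra get the default [0], which is a component, so that [stone_mu] is
    nonnegative on all sets. *)
Definition stone_rep A : E := xget 0 [set p | stone_approx A p].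

Lemma stone_repP A : stone_sigma A -> stone_approx A (stone_rep A).
Proof.
move=> [p Ap].
exact: (@xgetPex _ 0 [set p | stone_approx A p] (ex_intro _ p Ap)).
Qed.

Lemma stone_repE A p : stone_approx A p -> stone_rep A = p.
Proof.
by move=> Ap; apply: (stone_approx_uniq _ Ap); apply: stone_repP; exists p.
Qed.

Definition stone_mu A : \bar R := (m (stone_rep A))%:E.

Lemma stone_muE A p : stone_approx A p -> stone_mu A = (m p)%:E.
Proof. by move=> Ap; rewrite /stone_mu (stone_repE Ap). Qed.

Lemma stone_mu0 : stone_mu set0 = 0%E.
Proof. by rewrite (stone_muE (stone_approx_null stone_null0)) stone_mass0. Qed.

Lemma stone_muT : stone_mu setT = 1%E.
Proof.
rewrite -setC0 (stone_muE (stone_approxC (stone_approx_null stone_null0))).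
by rewrite subr0 m_unit.
Qed.

Lemma stone_mu_eq0 A : stone_sigma A -> stone_mu A = 0%E -> stone_null A.
Proof.
move=> [p Ap]; rewrite (stone_muE Ap) => -[mp]; have [cp nA] := Ap.
have p0 : p = 0 by apply/le_anti; rewrite m_eq0//=; case: cp.
by apply: stone_nullS nA => U AU; left; split=> //; rewrite p0 => /(@stone_set0 _ _ e).
Qed.

(** The approximating components are pairwise disjoint, so the partial sums are the masses of the
    partial joins, which differ from [m s] by the mass of a remainder tending to [0]. *)
Lemma stone_mu_sigma_additive (F : nat -> set (set_system E)) :
  (forall n, stone_sigma (F n)) -> trivIset setT F ->
  (\sum_(0 <= i < n) stone_mu (F i))%E @[n --> \oo] -->
    stone_mu (\bigcup_n F n).
Proof.
move=> SF tF; pose p n := stone_rep (F n).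
have Fp n : stone_approx (F n) (p n) by exact: stone_repP.
have cp n : comp (p n) by case: (Fp n).
have [s ps cs] := component_seq_sup E_dc cp.
rewrite (stone_muE (stone_approx_bigcup Fp ps)).
have pp i j : i != j -> p i ⊓ p j <= 0.
  move=> ij; apply: (stone_approx_disjoint (Fp i) (Fp j)).
  apply/seteqP; split=> // U [Fi Fj]; move/eqP: ij; apply.
  by apply: tF => //; exists U.
have pJ n k : (n < k)%N -> join_seq p n ⊓ p k <= 0.
  elim: n => [|n IH] nk /=; first by apply: pp; rewrite neq_ltn nk.
  have cJ := join_seq_component cp n.
  have [J0 _ _] := cJ; have [p0 _ _] := cp n.+1; have [pk0 _ _] := cp k.
  apply: (@riesz_meet_le0S _ _ _ _ (join_seq p n + p n.+1) (p k)) => //.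
    by rewrite riesz_leUx riesz_leDl//= addrC riesz_leDl.
  rewrite riesz_meetC; apply: riesz_meet_le0D => //; rewrite riesz_meetC.
    by apply: IH; exact: ltn_trans nk.
  by apply: pp; rewrite neq_ltn nk.
have mJ n : m (join_seq p n) = \sum_(0 <= i < n.+1) m (p i).
  elim: n => [|n IH] /=; first by rewrite big_nat1.
  have cJ := join_seq_component cp n.
  by rewrite component_disjointE ?pJ// m_add ?pJ// IH [RHS]big_nat_recr.
rewrite (_ : (fun n => _) = (fun n => (\sum_(0 <= i < n) m (p i))%:E)); last first.
  by apply/funext => n; rewrite sumEFin.
apply: cvg_EFin; first by near=> n.
apply/cvgrPdist_lt => eps eps0.
have [n mn] := stone_mass_join_seq cp ps eps0.
near=> k.
(* The first [k] terms add up to the mass of [join_seq p k.-1], because the join up to index [n]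
   involves [n.+1] components. *)
have kn : (n <= k.-1)%N by near: k; exists n.+1 => // k /=; case: k.
have k0 : (0 < k)%N by near: k; exists 1%N.
rewrite /= -(prednK k0) -mJ.
have cJ := join_seq_component cp.
have Js i : join_seq p i <= s.
  by apply: join_seq_le => j; case: ps => + _; apply; exists j.
rewrite (stone_massD (cJ k.-1) cs (Js _)) addrC addKr ger0_norm; last first.
  by apply/m_ge0/componentI => //; exact: componentC.
apply: le_lt_trans mn; apply: le_stone_mass.
- by apply: componentI => //; exact: componentC.
- by apply: componentI => //; exact: componentC.
- by rewrite riesz_leI2// riesz_leD// riesz_leN le_join_seq.
Unshelve. all: by end_near. Qed.

End StoneMeasure.

(** * Values at a point of the Stone space *)

Section StoneValue.
Context {R : realType} {E : rieszType R}.
Hypothesis E_dc : dedekind_complete E.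
Variable e : E.
Hypothesis e_ge0 : 0 <= e.
Implicit Types (p q r x y z : E) (s t u v : R) (U : set_system E).

(** [nonpos_at U (x - y)] is the total preorder [x <= y] at the point [U]: the positive part of the
    difference vanishes on some component in [U]. *)
Definition nonpos_at U z :=
  exists p, [/\ component e p, U (components_below e p) & p ⊓ riesz_pos z <= 0].

Section Point.
Variable U : set_system E.
Hypothesis sU : stone_point e U.
Let K := nonpos_at U.

Let FU : Filter U. Proof. by case: sU. Qed.

Lemma nonpos_atS z w : z <= w -> K w -> K z.
Proof.
move=> zw [p [cp Up pw]]; exists p; split=> //.
by apply: riesz_meet_le0S pw => //; exact: riesz_leP.
Qed.

Lemma nonpos_at_le0 z : z <= 0 -> K z.
Proof.
move=> z0; have ce := component_unit e_ge0; have c0 := component0 e_ge0.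
have [p [cp Up]] : exists p, component e p /\ U (components_below e p).
  have [_ [_ /(_ _ ce)[h|h]]] := sU; first by exists e.
  by exists (e - e); split=> //; exact: componentC.
exists p; split=> //; apply: le_trans (riesz_leIr _ _) _.
by rewrite riesz_pos_le0.
Qed.

(** The components witnessing [K z] and [K w] meet in a component of [U] that is disjoint from both
    positive parts. Stability under sums and joins are the two uses. *)
Lemma nonpos_at_pos z w a : K z -> K w ->
  riesz_pos a <= riesz_pos z + riesz_pos w -> K a.
Proof.
move=> [p [cp Up pz]] [q [cq Uq qw]] azw; exists (p ⊓ q).
split; first exact: componentI.
  have : stone_set e (p ⊓ q) U by rewrite stone_setI; split; split.
  by case.
have cpq := componentI cp cq; have [p0 _ _] := cpq.
apply: (riesz_meet_le0S (lexx _) azw).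
apply: riesz_meet_le0D => //; try exact: riesz_pos_ge0.
  by apply: riesz_meet_le0S pz => //; exact: riesz_leIl.
by apply: riesz_meet_le0S qw => //; exact: riesz_leIr.
Qed.

Lemma nonpos_atD z w : K z -> K w -> K (z + w).
Proof. by move=> Kz Kw; apply: nonpos_at_pos Kz Kw _; exact: riesz_posD. Qed.

Lemma nonpos_atU z w : K z -> K w -> K (z ⊔ w).
Proof.
move=> Kz Kw; apply: nonpos_at_pos Kz Kw _.
have := riesz_pos_ge0 z; have := riesz_pos_ge0 w => w0 z0.
rewrite {1}/riesz_pos !riesz_leUx riesz_addr_ge0// andbT.
rewrite (le_trans (riesz_le_pos z)) ?riesz_leDl//=.
by rewrite addrC (le_trans (riesz_le_pos w)) ?riesz_leDl.
Qed.

Lemma nonpos_atZ c z : 0 <= c -> K z -> K (c *: z).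
Proof.
move=> c0 [p [cp Up pz]]; exists p; split=> //.
have [p0 _ _] := cp; have z0 := riesz_pos_ge0 z.
apply: (riesz_meet_le0S (lexx _) _ (riesz_meet_le0Z p0 z0 c0 pz)).
by rewrite riesz_leUx riesz_leZ ?riesz_le_pos//= riesz_scaler_ge0.
Qed.

(** [U] contains either the component where [z <= 0] or its complement, where [z >= 0]. *)
Lemma nonpos_at_total z : K z \/ K (- z).
Proof.
have [q [cq qz qz']] := component_sign E_dc e_ge0 z.
have [_ [_ /(_ _ cq)[Uq|Uq]]] := sU; first by left; exists q.
by right; exists (e - q); split=> //; exact: componentC.
Qed.

(** If [t > 0], a component disjoint from [t *: e] is disjoint from [e], which dominates it; it is
    therefore zero and cannot belong to [U]. *)
Lemma nonpos_at_unit t : K (t *: e) -> t <= 0.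
Proof.
move=> [p [[p0 pe pp] Up pt]]; rewrite leNgt; apply/negP => t0.
have te : 0 <= t *: e by rewrite riesz_scaler_ge0// ltW.
have /(riesz_meet_le0Z p0 te) : p ⊓ (t *: e) <= 0.
  by apply: riesz_meet_le0S pt => //; exact: riesz_le_pos.
have tV : 0 <= t^-1 by rewrite invr_ge0 ltW.
move=> /(_ _ tV); rewrite scalerA mulVf ?gt_eqF// scale1r riesz_meet_l// => p0'.
apply: (@stone_set0 _ _ e U); apply: stone_setS p0' _ _.
by split.
Qed.

(** The margin [eps] lets [x - v *: e] be infinitesimal at [U] without being zero on a component. *)
Definition value_at x v := forall eps, 0 < eps ->
  K (x - (v + eps) *: e) /\ K ((v - eps) *: e - x).

(** At [U] one has [(v - eps / 2) *: e <= x <= y <= (w + eps / 2) *: e], and [nonpos_at_unit]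
    compares the outer coefficients. *)
Lemma value_at_le x y v w : value_at x v -> value_at y w -> K (x - y) -> v <= w.
Proof.
move=> xv yw xy; apply/ler_addgt0Pr => eps eps0.
have eps2 : 0 < eps / 2 by rewrite divr_gt0.
have [_ h1] := xv _ eps2; have [h2 _] := yw _ eps2.
have := nonpos_atD h1 (nonpos_atD xy h2).
rewrite addrA -[_ - x + _]addrA (addrA (- x)) addNr add0r.
have -> : (v - eps / 2) *: e - y + (y - (w + eps / 2) *: e) =
   (v - eps / 2 - (w + eps / 2)) *: e.
  by rewrite addrA subrK [RHS]scalerBl.
by move/nonpos_at_unit; lra.
Qed.

Lemma value_at_uniq x v w : value_at x v -> value_at x w -> v = w.
Proof.
move=> xv xw; apply/le_anti/andP; split.
  by apply: (value_at_le xv xw); rewrite subrr; exact: nonpos_at_le0.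
by apply: (value_at_le xw xv); rewrite subrr; exact: nonpos_at_le0.
Qed.

Lemma value_atN x v : value_at x v -> value_at (- x) (- v).
Proof.
move=> xv eps /xv[h1 h2]; split.
  by rewrite addrC -scaleNr opprD opprK.
by rewrite opprK addrC -opprD scaleNr.
Qed.

Lemma value_atD x y v w : value_at x v -> value_at y w ->
  value_at (x + y) (v + w).
Proof.
move=> xv yw eps eps0; have eps2 : 0 < eps / 2 by rewrite divr_gt0.
have [h1 h2] := xv _ eps2; have [h3 h4] := yw _ eps2; split.
  have := nonpos_atD h1 h3; rewrite addrACA -opprD -scalerDl.
  by rewrite (_ : v + _ + _ = v + w + eps)//; lra.
have := nonpos_atD h2 h4; rewrite addrACA -opprD -scalerDl.
by rewrite (_ : v - _ + _ = v + w - eps)//; lra.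
Qed.

Lemma value_at0 : value_at 0 0.
Proof.
move=> eps eps0; have h : - (eps *: e) <= 0.
  by rewrite riesz_leN0 riesz_scaler_ge0// ltW.
by split; apply: nonpos_at_le0; rewrite ?add0r ?subr0// scaleNr.
Qed.

Lemma value_at_unit : value_at e 1.
Proof.
move=> eps eps0; have h : - (eps *: e) <= 0.
  by rewrite riesz_leN0 riesz_scaler_ge0// ltW.
split; apply: nonpos_at_le0.
  by rewrite scalerDl scale1r opprD addrA subrr add0r.
by rewrite scalerBl scale1r addrC addrA addNr add0r.
Qed.

Lemma value_atZ_gt0 c x v : 0 < c -> value_at x v -> value_at (c *: x) (c * v).
Proof.
move=> c0 xv eps eps0; have epsc : 0 < eps / c by rewrite divr_gt0.
have [/(nonpos_atZ (ltW c0)) h1 /(nonpos_atZ (ltW c0)) h2] := xv _ epsc.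
have ce : c * (eps / c) = eps by rewrite mulrC divfK ?gt_eqF.
split; first by move: h1; rewrite scalerBr scalerA mulrDr ce.
by move: h2; rewrite scalerBr scalerA mulrBr ce.
Qed.

Lemma value_atZ c x v : value_at x v -> value_at (c *: x) (c * v).
Proof.
move=> xv; case: (ltgtP c 0) => [c0|c0|->].
- rewrite -[c]opprK scaleNr mulNr; apply/value_atN/value_atZ_gt0 => //.
  by rewrite oppr_gt0.
- exact: value_atZ_gt0.
- by rewrite scale0r mul0r; exact: value_at0.
Qed.

Lemma value_at_joinl x y v w : value_at x v -> value_at y w -> w <= v ->
  value_at (x ⊔ y) v.
Proof.
move=> xv yw wv eps eps0; have [h1 h2] := xv _ eps0; have [h3 _] := yw _ eps0.
split.
  rewrite riesz_joinD; apply: nonpos_atU => //; apply: nonpos_atS h3.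
  rewrite riesz_leD// riesz_leN -riesz_subr_ge0 -scalerBl riesz_scaler_ge0//.
  by rewrite subr_ge0 lerD2r.
by apply: nonpos_atS h2; rewrite riesz_leD// riesz_leN riesz_leUl.
Qed.

Lemma value_at_join x y v w : value_at x v -> value_at y w ->
  value_at (x ⊔ y) (Num.max v w).
Proof.
move=> xv yw; case: (leP v w) => [vw|/ltW wv].
  by rewrite riesz_joinC; exact: value_at_joinl xv vw.
exact: value_at_joinl yw wv.
Qed.

Lemma value_at_meet x y v w : value_at x v -> value_at y w ->
  value_at (x ⊓ y) (Num.min v w).
Proof.
move=> xv yw; rewrite -[x ⊓ y]opprK riesz_oppI -[Num.min _ _]opprK oppr_min.
by apply/value_atN/value_at_join; exact: value_atN.
Qed.

Lemma value_at_ge x v t : value_at x v -> K (t *: e - x) -> t <= v.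
Proof.
move=> xv; apply: value_at_le xv; have := value_atZ t value_at_unit.
by rewrite mulr1.
Qed.

Lemma value_at_lex x v t : value_at x v -> K (x - t *: e) -> v <= t.
Proof.
move=> xv; apply: (value_at_le xv); have := value_atZ t value_at_unit.
by rewrite mulr1.
Qed.

(** The value is the infimum of the [s] with [x <= s *: e] at [U]. The bound on [- x] makes these
    [s] bounded below, and totality of the preorder gives the estimate from below. *)
Lemma value_at_ex x t : K (x - t *: e) -> K (- x - t *: e) ->
  exists v, value_at x v.
Proof.
move=> xt Nxt; pose A := [set s : R | K (x - s *: e)].
have Alb s : A s -> - t <= s.
  move=> As; have := nonpos_atD As Nxt.
  rewrite addrACA subrr add0r -opprD -scalerDl -scaleNr => /nonpos_at_unit.
  by lra.
have hA : has_inf A by split; [exists t|exists (- t) => s; exact: Alb].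
exists (inf A) => eps eps0; split.
  have [s As /ltW sA] := inf_adherent eps0 hA.
  apply: nonpos_atS As; rewrite riesz_leD// riesz_leN.
  by rewrite -riesz_subr_ge0 -scalerBl riesz_scaler_ge0// subr_ge0.
have [h|] := nonpos_at_total (x - (inf A - eps) *: e); last by rewrite opprB.
have := ge_inf hA.2 h; lra.
Qed.

End Point.

Definition stone_value x U : R := xget 0 [set v | value_at U x v].

Lemma stone_valueE x U v : stone_point e U -> value_at U x v ->
  stone_value x U = v.
Proof.
move=> sU xv; apply: (value_at_uniq sU _ xv).
exact: (@xgetPex _ 0 [set v | value_at U x v] (ex_intro _ v xv)).
Qed.

Definition finite_at x U := exists v, value_at U x v.

Lemma stone_valueP x U : finite_at x U -> value_at U x (stone_value x U).
Proof. by move=> h; exact: (@xgetPex _ 0 [set v | value_at U x v] h). Qed.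

End StoneValue.

(** * The representation on the Stone space *)

Section AlmostEverywhere.
Context d (X : measurableType d) (R : realType).
Variable mu : {measure set X -> \bar R}.
Implicit Types P Q : X -> Prop.

Lemma aeS P Q : (forall x, P x -> Q x) ->
  {ae mu, forall x, P x} -> {ae mu, forall x, Q x}.
Proof. exact: filterS. Qed.

Lemma aeI P Q : {ae mu, forall x, P x} -> {ae mu, forall x, Q x} ->
  {ae mu, forall x, P x /\ Q x}.
Proof. exact: filterI. Qed.

Lemma ae_forall (Q : nat -> X -> Prop) : (forall n, {ae mu, forall x, Q n x}) ->
  {ae mu, forall x, forall n, Q n x}.
Proof.
move=> hQ; apply: (negligibleS _ (negligible_bigcup hQ)).
by move=> x /existsNP[n nQ]; exists n.
Qed.

End AlmostEverywhere.

Section L0Theory.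
Context d (X : measurableType d) (R : realType).
Variable mu : {measure set X -> \bar R}.
Implicit Types u v : L0 mu.

Lemma L0_funD u v :
  {ae mu, forall x, L0_fun (u + v) x = L0_fun u x + L0_fun v x}.
Proof. exact: L0_classK. Qed.

Lemma L0_funZ a u : {ae mu, forall x, L0_fun (a *: u) x = a * L0_fun u x}.
Proof. exact: L0_classK. Qed.

Lemma L0_fun_meet u v :
  {ae mu, forall x, L0_fun (u ⊓ v) x = Num.min (L0_fun u x) (L0_fun v x)}.
Proof. exact: L0_classK. Qed.

Lemma L0_fun_join u v :
  {ae mu, forall x, L0_fun (u ⊔ v) x = Num.max (L0_fun u x) (L0_fun v x)}.
Proof. exact: L0_classK. Qed.

End L0Theory.

Section StoneRepresentation.
Context {R : realType} {E : rieszType R}.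
Hypothesis E_arch : archimedean E.
Hypothesis E_dc : dedekind_complete E.
Variable e : E.
Hypothesis e_ge0 : 0 <= e.
Hypothesis e_unit : forall x, 0 <= x -> e ⊓ x <= 0 -> x <= 0.
Variable m : E -> R.
Hypothesis m_prob : component_probability e m.
Implicit Types (p q r x y z : E) (U : set_system E) (t : R).

Local Notation S := (stone_set e).
Local Notation X := (g_sigma_algebraType (stone_sigma e m)).

(** Let [q n] be the component where [riesz_abs x <= n%:R *: e]. A point containing some [q n] gives
    [x] a value, so the set is covered by each [e - join_seq q n]; by the Archimedean property these
    decrease to [0]. *)
Lemma stone_null_infinite x :
  stone_null e m [set U | stone_point e U /\ ~ finite_at e x U].
Proof.
have /choice[q qP] : forall n : nat, exists q,
    [/\ component e q, q ⊓ riesz_pos (riesz_abs x - n%:R *: e) <= 0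
      & (e - q) ⊓ riesz_pos (n%:R *: e - riesz_abs x) <= 0].
  move=> n; have [q [cq h1 h2]] := component_sign E_dc e_ge0 (riesz_abs x - n%:R *: e).
  by exists q; split=> //; rewrite -[n%:R *: e - _]opprB.
have cq n : component e (q n) by case: (qP n).
move=> eps eps0.
have cJ := join_seq_component cq.
have [n mn] : exists n, m (e - join_seq q n) < eps.
  apply: (component_probability_cvg0 m_prob (p := fun n => e - join_seq q n)) => //.
  - by move=> n; exact: componentC.
  - by move=> n; rewrite riesz_leD// riesz_leN join_seqS.
  move=> z zJ; have zq n : z <= e - q n.
    by apply: le_trans (zJ n) _; rewrite riesz_leD// riesz_leN join_seq_ge.
  rewrite -riesz_pos_le0.
  suff -> : riesz_pos z = 0 by [].
  apply: (E_arch (riesz_pos_ge0 z)) => n.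
  have eq : 0 <= e - q n by case: (componentC (cq n)).
  have zpq : riesz_pos z <= e - q n by rewrite riesz_leUx zq.
  have ne : riesz_pos z *+ n <= n%:R *: e.
    rewrite -scaler_nat riesz_leZ// (le_trans zpq)// riesz_geBl//.
    by case: (cq n).
  have zn0 : 0 <= riesz_pos z *+ n.
    by rewrite -scaler_nat riesz_scaler_ge0// riesz_pos_ge0.
  (* The last term is disjoint from [e - q n], which is above [riesz_pos z]; so all multiples of
     [riesz_pos z] stay below [riesz_abs x]. *)
  have h : riesz_pos z *+ n <= riesz_abs x + riesz_pos (n%:R *: e - riesz_abs x).
    apply: le_trans ne _; rewrite -[leLHS](subrK (riesz_abs x)) addrC.
    by rewrite riesz_leD// riesz_le_pos.
  rewrite -(riesz_meet_l h).
  apply: le_trans (riesz_meetD_le zn0 (riesz_abs_ge0 x) (riesz_pos_ge0 _)) _.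
  apply: (@le_trans _ _ (riesz_abs x + 0)); last by rewrite addr0.
  apply: riesz_leD; first exact: riesz_leIr.
  rewrite riesz_meetC -[riesz_pos z *+ n]scaler_nat; apply: riesz_meet_le0Z => //.
  - exact: riesz_pos_ge0.
  - exact: riesz_pos_ge0.
  rewrite riesz_meetC; have [_ _] := qP n; exact: riesz_meet_le0S.
exists (e - join_seq q n); split=> //; first exact: componentC.
move=> U [[sU nf] _]; apply/stone_setC => // /(stone_set_join_seq cq)[k _ [_ Uq]].
apply: nf; apply: (value_at_ex E_dc e_ge0 sU (t := k%:R)).
  exists (q k); split=> //; have [_ + _] := qP k; apply: riesz_meet_le0S => //.
  by rewrite riesz_leP// riesz_leD// riesz_abs_ge.
exists (q k); split=> //; have [_ + _] := qP k; apply: riesz_meet_le0S => //.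
by rewrite riesz_leP// riesz_leD// riesz_abs_geN.
Qed.

(** Where [x] has a value, that value exceeds [t] exactly on the union of the [S (e - q n)], with
    [e - q n] the component where [x >= s n *: e]. The shift in [s n] turns a weak inequality into a
    strict one. *)
Lemma stone_sigma_value_gt x t :
  stone_sigma e m [set U | t < stone_value e x U].
Proof.
pose s (n : nat) := t + n.+1%:R^-1.
have /choice[q qP] := fun n => component_sign E_dc e_ge0 (x - s n *: e).
have cq n : component e (q n) by case: (qP n).
have cp n := componentC (cq n).
have [r rs _] := component_seq_sup E_dc cp.
have Sp n : stone_approx e m (S (e - q n)) (e - q n).
  exact: (stone_approx_set e_ge0 m_prob).
exists r; have := stone_approx_bigcup E_dc e_ge0 m_prob Sp rs.
move=> /(stone_approx_eqnull E_dc e_ge0 m_prob); apply.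
move=> eps /(stone_null_infinite x)[p [pc pS mp]]; exists p; split=> //.
move=> U [BU sU]; apply: pS; split=> //; split=> // /stone_valueP xv.
case: BU => -[].
  move=> [n _ [_ Uq]]; apply; rewrite /=.
  have : s n <= stone_value e x U.
    apply: (value_at_ge e_ge0 sU xv); exists (e - q n); split=> //.
    by rewrite -[s n *: e - x]opprB; case: (qP n).
  by apply: lt_le_trans; rewrite ltrDl invr_gt0.
move=> /= tx; apply.
pose n := Num.bound (stone_value e x U - t)^-1.
have tn : s n < stone_value e x U.
  rewrite -ltrBrDl invf_plt ?posrE ?subr_gt0//.
  have h0 : 0 <= (stone_value e x U - t)^-1 by rewrite invr_ge0 subr_ge0 ltW.
  apply: lt_trans (archi_boundP h0) _; rewrite ltr_nat.
  exact: ltnSn.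
exists n => //; apply/stone_setC => // -[_ Uq]; move: tn; rewrite ltNge => /negP; apply.
by apply: (value_at_lex e_ge0 sU xv); exists (q n); split=> //; case: (qP n).
Qed.

Lemma stone_measurableE : @measurable _ X = stone_sigma e m.
Proof. exact/measurable_g_measurableTypeE/stone_sigma_algebra. Qed.

Lemma measurable_stone_value x : measurable_fun [set: X] (stone_value e x).
Proof.
move=> mD; apply: (measurability _ (RGenOInfty.measurableE R)) => //.
move=> _ [_ [t ->] <-]; rewrite setTI stone_measurableE.
rewrite (_ : _ @^-1` _ = [set U | t < stone_value e x U]); last first.
  by apply/seteqP; split=> U /=; rewrite in_itv/= andbT.
exact: stone_sigma_value_gt.
Qed.

Let mu_X : set X -> \bar R := stone_mu e m.

Let mu_X0 : mu_X set0 = 0%E.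
Proof. exact: stone_mu0. Qed.

Let mu_X_ge0 A : (0 <= mu_X A)%E.
Proof.
rewrite lee_fin; apply: (component_probability_ge0 m_prob).
rewrite /stone_rep; case: xgetP => [p _ []//|_]; exact: component0.
Qed.

Let mu_X_additive : semi_sigma_additive mu_X.
Proof.
move=> F; rewrite stone_measurableE => mF tF _.
exact: stone_mu_sigma_additive.
Qed.

HB.instance Definition _ :=
  isMeasure.Build _ X R mu_X mu_X0 mu_X_ge0 mu_X_additive.

HB.instance Definition _ :=
  Measure_isProbability.Build _ X R mu_X (stone_muT E_dc e_ge0 m_prob).

Definition stone_probability : probability X R := mu_X.
Local Notation P := stone_probability.

(** Every null set belongs to the sigma-algebra, approximated by the component [0], so the measure
    is complete. *)
Lemma stone_aeP (Q : X -> Prop) :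
  {ae P, forall U, Q U} <-> stone_null e m (~` [set U | Q U]).
Proof.
split=> [[A [mA A0 QA]]|nQ].
  apply: stone_nullS QA _; apply: (stone_mu_eq0 E_dc e_ge0 m_prob) => //.
  by rewrite -stone_measurableE.
exists (~` [set U | Q U]); split=> //.
  by rewrite stone_measurableE; exists 0; exact: stone_approx_null.
have := stone_muE E_dc e_ge0 m_prob (stone_approx_null e_ge0 nQ).
by rewrite (stone_mass0 e_ge0 m_prob).
Qed.

Lemma stone_ae_value x :
  {ae P, forall U : X, stone_point e U /\ value_at e U x (stone_value e x U)}.
Proof.
apply/stone_aeP => eps /(stone_null_infinite x)[p [cp pS mp]].
exists p; split=> // U [nU sU]; apply: pS; split=> //; split=> //.
by move=> /stone_valueP h; apply: nU.
Qed.

(** For the converse and [t > 0], the component where [x - y >= t *: e] has a null Stone set, so it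
    is zero. Since only [0] is disjoint from [e], this gives [x - y <= t *: e] for all [t > 0], and
    the Archimedean property gives [x <= y]. *)
Lemma stone_value_le x y :
  {ae P, forall U : X, stone_value e x U <= stone_value e y U} <-> x <= y.
Proof.
split=> [xy|xy]; last first.
  apply: aeS (aeI (stone_ae_value x) (stone_ae_value y)).
  move=> U [[sU xv] [_ yv]]; apply: (value_at_le e_ge0 sU xv yv).
  apply: nonpos_at_le0 => //; rewrite -(subrr y); exact: riesz_leD.
rewrite -riesz_subr_ge0 -riesz_leN0 opprB.
set z := x - y.
have z0 : {ae P, forall U : X, stone_point e U /\
    exists2 v, value_at e U z v & v <= 0}.
  apply: aeS (aeI xy (aeI (stone_ae_value x) (stone_ae_value y))).
  move=> U [xyU [[sU xv] [_ yv]]]; split=> //.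
  exists (stone_value e x U - stone_value e y U); last by rewrite subr_le0.
  by apply: value_atD => //; exact: value_atN.
have zt t : 0 < t -> z <= t *: e.
  move=> t0; rewrite -[leRHS]add0r -riesz_leBlDr -riesz_pos_le0.
  have [q [cq q1 q2]] := component_sign E_dc e_ge0 (z - t *: e).
  apply: e_unit; first exact: riesz_pos_ge0.
  apply: riesz_meet_le0S q1 => //.
  rewrite -[leRHS]add0r -riesz_leBlDr.
  apply: (stone_null_set m_prob (componentC cq)).
  have /stone_aeP := z0; apply: stone_nullS => U [sU Uq] [_ [v zv v0]].
  have : t <= v.
    by apply: (value_at_ge e_ge0 sU zv); exists (e - q); split;
      [exact: componentC| |rewrite -[t *: e - z]opprB].
  by rewrite leNgt (le_lt_trans v0).
rewrite -riesz_pos_le0.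
suff -> : riesz_pos z = 0 by [].
apply: (E_arch (y := e) (riesz_pos_ge0 z)) => n.
have n0 : 0 < n.+1%:R :> R by [].
(* Passing to [n.+1] makes the multiplier invertible, so that [t] can be its inverse. *)
apply: (@le_trans _ _ (riesz_pos z *+ n.+1)).
  by rewrite mulrSr riesz_leDl ?riesz_pos_ge0.
have -> : e = n.+1%:R *: (n.+1%:R^-1 *: e).
  by rewrite scalerA mulfV ?scale1r// gt_eqF.
rewrite -scaler_nat riesz_leZ// riesz_leUx zt ?invr_gt0//=.
by rewrite riesz_scaler_ge0.
Qed.


Lemma stone_value_ae_eq x (Q : X -> R) :
  {ae P, forall U : X, stone_point e U -> value_at e U x (Q U)} ->
  {ae P, forall U : X, stone_value e x U = Q U}.
Proof.
move=> xQ; apply: aeS (aeI xQ (stone_ae_value x)) => U [h [sU _]].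
by apply: (stone_valueE e_ge0 sU); exact: h.
Qed.

Lemma stone_valueD x y : {ae P, forall U : X,
  stone_value e (x + y) U = stone_value e x U + stone_value e y U}.
Proof.
apply: stone_value_ae_eq; apply: aeS (aeI (stone_ae_value x) (stone_ae_value y)).
by move=> U [[sU xv] [_ yv]] _; exact: value_atD.
Qed.

Lemma stone_valueZ a x : {ae P, forall U : X,
  stone_value e (a *: x) U = a * stone_value e x U}.
Proof.
apply: stone_value_ae_eq; apply: aeS (stone_ae_value x).
by move=> U [sU xv] _; exact: value_atZ.
Qed.

Lemma stone_value_join x y : {ae P, forall U : X,
  stone_value e (x ⊔ y) U = Num.max (stone_value e x U) (stone_value e y U)}.
Proof.
apply: stone_value_ae_eq; apply: aeS (aeI (stone_ae_value x) (stone_ae_value y)).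
by move=> U [[sU xv] [_ yv]] _; exact: value_at_join.
Qed.

Lemma stone_value_meet x y : {ae P, forall U : X,
  stone_value e (x ⊓ y) U = Num.min (stone_value e x U) (stone_value e y U)}.
Proof.
apply: stone_value_ae_eq; apply: aeS (aeI (stone_ae_value x) (stone_ae_value y)).
by move=> U [[sU xv] [_ yv]] _; exact: value_at_meet.
Qed.

Lemma stone_value_unit : {ae P, forall U : X, stone_value e e U = 1}.
Proof.
by apply: stone_value_ae_eq; apply: aeW => U sU; exact: value_at_unit.
Qed.

(** * Surjectivity of the representation *)

Hypothesis E_lat : laterally_complete E.

(** With [p n] the component approximating [F n], the elements [c n *: p n] are pairwise disjoint,
    and [x] is their supremum. Almost every point of [F n] contains [p n], on which [x] agrees with
    [c n *: e]. *)
Lemma stone_value_step (F : nat -> set X) (c : nat -> R) :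
  (forall n, measurable (F n)) -> trivIset setT F -> (forall n, 0 <= c n) ->
  exists x, {ae P, forall U : X, forall n, F n U -> stone_value e x U = c n}.
Proof.
move=> mF tF c0; pose p n := stone_rep e m (F n).
have Fp n : stone_approx e m (F n) (p n).
  by apply: stone_repP; rewrite -stone_measurableE.
have cp n : component e (p n) by case: (Fp n).
have p0 n : 0 <= p n by case: (cp n).
have pp i j : i != j -> p i ⊓ p j <= 0.
  move=> ij; apply: (stone_approx_disjoint E_dc e_ge0 m_prob (Fp i) (Fp j)).
  by apply/seteqP; split=> // U [Fi Fj]; move/eqP: ij; apply; apply: tF => //; exists U.
have d0 n : 0 <= c n *: p n by exact: riesz_scaler_ge0.
have dd i j : i != j -> (c i *: p i) ⊓ (c j *: p j) <= 0.
  move=> /pp ij; apply: riesz_meet_le0Z => //; rewrite riesz_meetC.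
  by apply: riesz_meet_le0Z => //; rewrite riesz_meetC.
have [x xD] : exists x, isLub (range (fun n => c n *: p n)) x.
  apply: E_lat; first by exists (c 0%N *: p 0%N), 0%N.
    by move=> _ [n _ <-].
  move=> _ _ [i _ <-] [j _ <-] ij; rewrite /riesz_disjoint !riesz_ge0_abs//.
  apply/le_anti; rewrite riesz_lexI !d0 !andbT; apply: dd.
  by apply: contra_notN ij => /eqP ->.
exists x.
suff h n : {ae P, forall U : X, F n U -> stone_value e x U = c n}.
  exact: ae_forall.
have nF : {ae P, forall U : X, F n U -> stone_point e U -> S (p n) U}.
  apply/stone_aeP; apply: stone_nullS (Fp n).2 => U /not_implyP[FU].
  by move=> /not_implyP[sU pU]; left.
apply: aeS (aeI nF (stone_ae_value x)) => U [h [sU _]] FU.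
apply: (stone_valueE e_ge0 sU) => eps eps0.
have [_ Up] := h FU sU.
have ee : 0 <= eps *: e by rewrite riesz_scaler_ge0// ltW.
split; exists (p n); split=> //.
  apply: (@riesz_meet_le0S _ _ _ _ (p n) (riesz_pos (x - c n *: e))) => //.
    apply: riesz_leP; apply: riesz_leD => //.
    by rewrite riesz_leN scalerDl riesz_leDl.
  (* Subtracting [c n *: e] and taking positive parts preserves the supremum, so each term can be
     checked alone: for [k = n] it is [0], and otherwise it is below [c k *: p k], which is disjoint
     from [p n]. *)
  have xD' : isLub [set riesz_pos (c k *: p k - c n *: e) | k in setT]
      (riesz_pos (x - c n *: e)).
    split=> [_ [k _ <-]|b Db].
      apply: riesz_leP; apply: riesz_leD => //.
      by case: xD => + _; apply; exists k.
    rewrite riesz_leUx riesz_leBlDr; apply/andP; split.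
      case: xD => _; apply => _ [k _ <-]; rewrite -riesz_leBlDr.
      by apply: le_trans (riesz_le_pos _) _; apply: Db; exists k.
    by apply: le_trans (riesz_pos_ge0 (c 0%N *: p 0%N - c n *: e)) _;
      apply: Db; exists 0%N.
  rewrite riesz_meetC; apply: (riesz_isLub_meet_le0 xD') => _ [k _ <-].
  have [->|kn] := eqVneq k n.
    apply: le_trans (riesz_leIl _ _) _; rewrite riesz_pos_le0 riesz_leBlDr add0r.
    by apply: riesz_leZ => //; case: (cp n).
  apply: (@riesz_meet_le0S _ _ _ _ (c k *: p k) (p n)) => //.
    by rewrite riesz_leUx d0 andbT riesz_geBl// riesz_scaler_ge0.
  rewrite riesz_meetC; apply: riesz_meet_le0Z => //; apply: pp.
  by rewrite eq_sym.
(* For the lower estimate, [(c n - eps) *: e - x] is at most [c n *: (e - p n)], which is disjoint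
   from [p n]. *)
have [_ pe pep] := cp n.
have ep : 0 <= e - p n by rewrite riesz_subr_ge0.
apply: (riesz_meet_le0S _ _ (riesz_meet_le0Z (p0 n) ep (c0 n) pep)) => //.
rewrite riesz_leUx riesz_scaler_ge0// andbT scalerBr riesz_leD//.
  by rewrite scalerBl riesz_geBl.
by rewrite riesz_leN; case: xD => + _; apply; exists n.
Qed.

(** Rounding [g] down to a multiple of [eps] gives a countable step function. *)
Lemma stone_value_approx (g : X -> R) (eps : R) : measurable_fun setT g ->
  (forall U, 0 <= g U) -> 0 < eps ->
  exists x, {ae P, forall U : X,
    stone_value e x U <= g U /\ g U <= stone_value e x U + eps}.
Proof.
move=> mg g0 eps0.
pose F n := g @^-1` `[n%:R * eps, n.+1%:R * eps[.
have mF n : measurable (F n).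
  by rewrite -[F n]setTI; apply: mg => //; exact: measurable_itv.
have FE n U : F n U -> Num.truncn (g U / eps) = n.
  rewrite /F /= in_itv/= => /andP[h1 h2]; apply: truncn_def.
  by rewrite ler_pdivlMr// ltr_pdivrMr// h1.
have tF : trivIset setT F.
  by move=> i j _ _ [U [/FE <- /FE <-]].
have [x xF] := stone_value_step mF tF (fun n => mulr_ge0 (ler0n R n) (ltW eps0)).
exists x; apply: aeS xF => U xF.
have := truncn_itv (divr_ge0 (g0 U) (ltW eps0)).
set n := Num.truncn _ => /andP[h1 h2].
have FU : F n U by rewrite /F /= in_itv/= -ler_pdivlMr// -ltr_pdivrMr// h1.
move: (FU); rewrite /F/= in_itv/= => /andP[nu un].
by rewrite (xF n FU) nu; split=> //; rewrite (le_trans (ltW un))// -natr1 mulrDl mul1r.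
Qed.

(** [x] is the supremum of the elements with values below [g], bounded by [x1 + e] for an
    approximant [x1] within [1]. An approximant [y] within [n.+1%:R^-1] satisfies
    [y <= x <= y + n.+1%:R^-1 *: e], so the value of [x] is within [n.+1%:R^-1] of [g] for every
    [n]. *)
Lemma stone_value_surj_ge0 (g : X -> R) : measurable_fun setT g ->
  (forall U, 0 <= g U) ->
  exists x, {ae P, forall U : X, stone_value e x U = g U}.
Proof.
move=> mg g0.
pose A := [set y | {ae P, forall U : X, stone_value e y U <= g U}].
have [x1 x1g] := stone_value_approx mg g0 ltr01.
have [x Ax] : exists x, isLub A x.
  apply: E_dc; split; first by exists x1; apply: aeS x1g => U [].
  exists (x1 + e) => y Ay; apply/stone_value_le.
  apply: aeS (aeI (aeI Ay x1g) (aeI (stone_valueD x1 e) stone_value_unit)).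
  by move=> U [[h1 [h2 h3]] [-> ->]]; exact: le_trans h3.
exists x.
have h n : {ae P, forall U : X, `|stone_value e x U - g U| <= n.+1%:R^-1}.
  have n0 : 0 < n.+1%:R^-1 :> R by rewrite invr_gt0.
  have [y yg] := stone_value_approx mg g0 n0.
  have yx : y <= x by case: Ax => + _; apply; apply: aeS yg => U [].
  have xy : x <= y + n.+1%:R^-1 *: e.
    case: Ax => _; apply => z Az; apply/stone_value_le.
    apply: aeS (aeI (aeI Az yg) (aeI (stone_valueD y (n.+1%:R^-1 *: e))
      (aeI (stone_valueZ n.+1%:R^-1 e) stone_value_unit))).
    by move=> U [[h1 [h2 h3]] [-> [-> ->]]]; rewrite mulr1; exact: le_trans h3.
  have /stone_value_le yx' := yx; have /stone_value_le xy' := xy.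
  apply: aeS (aeI (aeI yx' xy') (aeI yg (aeI (stone_valueD y (n.+1%:R^-1 *: e))
      (aeI (stone_valueZ n.+1%:R^-1 e) stone_value_unit)))).
  move=> U [[h1 h4] [[h2 h3] [E1 [E2 E3]]]]; rewrite E1 E2 E3 mulr1 in h4.
  rewrite ler_distl; apply/andP; split.
    by rewrite lerBlDr (le_trans h3)// lerD2r.
  by rewrite (le_trans h4)// lerD2r.
apply: aeS (ae_forall h) => U hU; apply/eqP; rewrite -subr_eq0 -normr_le0.
apply/ler_addgt0Pr => eps eps0; rewrite add0r.
apply: le_trans (hU (Num.bound eps^-1)) _.
rewrite invf_ple ?posrE//.
have h0 : 0 <= eps^-1 by rewrite invr_ge0 ltW.
by apply: le_trans (ltW (archi_boundP h0)) _; rewrite ler_nat leqnSn.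
Qed.

Lemma stone_value_surj (g : X -> R) : measurable_fun setT g ->
  exists x, {ae P, forall U : X, stone_value e x U = g U}.
Proof.
move=> mg.
have [x xg] := stone_value_surj_ge0 (measurable_funrpos mg) (fun U => funrpos_ge0 g U).
have [y yg] := stone_value_surj_ge0 (measurable_funrneg mg) (fun U => funrneg_ge0 g U).
exists (x + (-1) *: y).
apply: aeS (aeI (aeI xg yg) (aeI (stone_valueD x ((-1) *: y)) (stone_valueZ (-1) y))).
move=> U [[h1 h2] [-> ->]]; rewrite h1 h2 mulN1r.
by rewrite -[in RHS](funrposBneg g).
Qed.

(** * The lattice isomorphism onto L0 *)

Let stone_fun x : X -> R := stone_value e x.

HB.instance Definition _ x :=
  isMeasurableFun.Build _ _ X R (stone_fun x) (measurable_stone_value x).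

Definition stone_embedding x : L0 P := L0_class P (stone_fun x).

Lemma stone_embeddingE x :
  {ae P, forall U, L0_fun (stone_embedding x) U = stone_value e x U}.
Proof. exact: L0_classK. Qed.

Lemma stone_embedding_linear : linear stone_embedding.
Proof.
move=> a x y; apply: L0_funP.
apply: aeS (aeI (aeI (stone_embeddingE (a *: x + y))
    (aeI (L0_funD (a *: stone_embedding x) (stone_embedding y))
      (L0_funZ a (stone_embedding x))))
  (aeI (aeI (stone_embeddingE x) (stone_embeddingE y))
    (aeI (stone_valueD (a *: x) y) (stone_valueZ a x)))).
by move=> U [[-> [-> ->]] [[-> ->] [-> ->]]].
Qed.

Lemma stone_embedding_inj : injective stone_embedding.
Proof.
move=> x y xy; apply/le_anti/andP; split; apply/stone_value_le;
  apply: aeS (aeI (stone_embeddingE x) (stone_embeddingE y)) => U;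
  by rewrite xy => -[-> ->].
Qed.

Lemma stone_embedding_meet :
  {morph stone_embedding : x y / x ⊓ y}.
Proof.
move=> x y; apply: L0_funP.
apply: aeS (aeI (aeI (stone_embeddingE (x ⊓ y))
    (L0_fun_meet (stone_embedding x) (stone_embedding y)))
  (aeI (stone_value_meet x y) (aeI (stone_embeddingE x) (stone_embeddingE y)))).
by move=> U [[-> ->] [-> [-> ->]]].
Qed.

Lemma stone_embedding_join :
  {morph stone_embedding : x y / x ⊔ y}.
Proof.
move=> x y; apply: L0_funP.
apply: aeS (aeI (aeI (stone_embeddingE (x ⊔ y))
    (L0_fun_join (stone_embedding x) (stone_embedding y)))
  (aeI (stone_value_join x y) (aeI (stone_embeddingE x) (stone_embeddingE y)))).
by move=> U [[-> ->] [-> [-> ->]]].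
Qed.

Lemma stone_embedding_surj : range stone_embedding = [set: L0 P].
Proof.
apply/seteqP; split=> // u _.
have [x xu] := stone_value_surj (measurable_funPT (L0_fun u)).
exists x => //; apply: L0_funP.
by apply: aeS (aeI (stone_embeddingE x) xu) => U [-> ->].
Qed.

HB.instance Definition _ :=
  GRing.isLinear.Build R E (L0 P) *:%R stone_embedding stone_embedding_linear.

Lemma stone_representation :
  exists (d : measure_display) (X : measurableType d) (mu : probability X R)
     (T : {linear E -> L0 mu}),
     lattice_isomorphism T /\ range T = [set: L0 mu].
Proof.
exists _, X, P, stone_embedding; split; last exact: stone_embedding_surj.
split.
- exact: stone_embedding_inj.
- exact: stone_embedding_meet.
- exact: stone_embedding_join.
Qed.

End StoneRepresentation.

(** * The probability defined by a functional *)

Section FunctionalRepresentation.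
Context {R : realType} {E : rieszType R}.
Implicit Types x y z e : E.

(** If [x] is disjoint from [e], it is disjoint from the whole ideal. As
    [x <= riesz_abs (u a) + y a] with [u a] in the ideal, subadditivity of the meet leaves
    [x <= y a], and [y] decreases to [0]. *)
Lemma weak_order_unit_meet_le0 e : weak_order_unit e ->
  forall x, 0 <= x -> e ⊓ x <= 0 -> x <= 0.
Proof.
move=> [e0 eu] x x0 ex; have [A [leA [u [_ ue [y [[_ [_ y0]] uy]]]]]] := eu x.
apply: y0 => _ [a _ <-].
have [l] := in_idealP _ _ (ue a) => /andP[lu ul].
have ul' : riesz_abs (u a) <= `|l| *: e.
  have le : l *: e <= `|l| *: e.
    rewrite -riesz_subr_ge0 -scalerBl riesz_scaler_ge0 ?(ltW e0)//.
    by rewrite subr_ge0 ler_norm.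
  rewrite riesz_absP (le_trans ul le) andbT (le_trans _ lu)//.
  by rewrite riesz_leN.
have xu : x ⊓ riesz_abs (u a) <= 0.
  apply: (riesz_meet_le0S (lexx _) ul').
  by apply: riesz_meet_le0Z; rewrite ?(ltW e0)// riesz_meetC.
have h : x <= riesz_abs (u a) + y a.
  rewrite -[x in leLHS](subrK (u a)) addrC riesz_leD ?riesz_abs_ge//.
  by apply: le_trans (uy a); rewrite -opprB riesz_abs_geN.
rewrite -(riesz_meet_l h).
have y0a : 0 <= y a by apply: le_trans (uy a); exact: riesz_abs_ge0.
apply: le_trans (riesz_meetD_le x0 (riesz_abs_ge0 _) y0a) _.
by rewrite -[leRHS]add0r riesz_leD// riesz_leIr.
Qed.

Variables (e : E) (phi : {scalar (principal_ideal e)}).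
Hypothesis e0 : 0 < e.
Hypothesis phi_pos : strictly_positive phi.
Hypothesis phi_cont : order_continuous phi.

Let to_ideal x : principal_ideal e := insubd 0 x.

Let to_idealK x : 0 <= x -> x <= e -> ideal_val (to_ideal x) = x.
Proof.
move=> x0 xe; apply: insubdK; apply/in_idealP; exists 1.
by rewrite scale1r xe (le_trans _ x0)// riesz_leN0 ltW.
Qed.

Let ideal_gt0 (x : principal_ideal e) : 0 <= ideal_val x ->
  ~~ (ideal_val x <= 0) -> 0 < phi x.
Proof.
move=> x0 xn0; apply: phi_pos; rewrite lt_neqAle.
by apply/andP; split=> //; apply: contraNneq xn0 => <-.
Qed.

Let phi_ge0 (x : principal_ideal e) : 0 <= ideal_val x -> 0 <= phi x.
Proof.
move=> x0; have [h|/(ideal_gt0 x0)/ltW//] := boolP (ideal_val x <= 0).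
have -> : x = 0 by apply/val_inj/le_anti; rewrite /= h.
by rewrite linear0.
Qed.

Let phi_e0 : 0 < phi (to_ideal e).
Proof.
have eE := to_idealK (ltW e0) (lexx e).
by apply: ideal_gt0; rewrite eE ?(ltW e0)// (lt_geF e0).
Qed.

Definition normalized_mass x : R := phi (to_ideal x) / phi (to_ideal e).

Lemma normalized_massP : component_probability e normalized_mass.
Proof.
split.
- move=> p [p0 pe _]; apply: divr_ge0; last exact: ltW.
  by apply: phi_ge0; rewrite to_idealK.
- by rewrite /normalized_mass divff// gt_eqF.
- move=> p q cp cq pq; rewrite /normalized_mass -mulrDl -linearD; congr (phi _ / _).
  have [p0 pe _] := cp; have [q0 qe _] := cq.
  have [pq0 pqe _] : component e (p + q).
    by rewrite -(component_disjointE cp cq pq); exact: componentU.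
  by apply/val_inj; rewrite /= !to_idealK.
- move=> p [p0 pe _] /eqP; rewrite mulf_eq0 invr_eq0 (gt_eqF phi_e0) orbF => /eqP h.
  apply: contrapT => /negP pn0.
  have := @ideal_gt0 (to_ideal p); rewrite to_idealK// => /(_ p0 pn0).
  by rewrite h ltxx.
move=> p cp pS p_inf eps eps0.
have pE n : ideal_val (to_ideal (p n)) = p n by case: (cp n) => *; rewrite to_idealK.
have pS' a b : (a <= b)%N -> p b <= p a.
  elim: b => [|b IH]; first by rewrite leqn0 => /eqP ->.
  by rewrite leq_eqVlt => /predU1P[->//|/IH]; exact: le_trans (pS b).
have dir : directed (fun a b : nat => (a <= b)%N).
  split; [by exists 0%N|by []|by move=> a b c; exact: leq_trans|].
  by move=> a b; exists (maxn a b); rewrite leq_maxl leq_maxr.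
(* The sequence dominates itself, and its infimum [0] in [E] is also its infimum within the
   ideal. *)
have cvg0 : order_cvg (fun a b : nat => (a <= b)%N) (fun n => to_ideal (p n)) 0.
  exists (fun n => to_ideal (p n)); split; last first.
    move=> n; rewrite subr0 riesz_ge0_abs//.
    by rewrite [_ <= _](_ : _ = (0 <= ideal_val (to_ideal (p n))))// pE; case: (cp n).
  split.
    move=> a b ab; rewrite [_ <= _](_ : _ =
      (ideal_val (to_ideal (p b)) <= ideal_val (to_ideal (p a))))// !pE.
    exact: pS'.
  split=> [_ [n _ <-]|z zp].
    by rewrite [(_ <= _)%O](_ : _ = (0 <= ideal_val (to_ideal (p n))))// pE; case: (cp n).
  rewrite [(_ <= _)%O](_ : _ = (ideal_val z <= 0))//.
  by apply: p_inf => n; rewrite -pE; apply: (zp (to_ideal (p n))); exists n.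
have := phi_cont dir cvg0.
move=> /(_ _ (nbhsx_ballx 0 _ (mulr_gt0 eps0 phi_e0))).
move=> [n _ /(_ n (leqnn n))]; rewrite /ball/= sub0r normrN => h.
exists n; rewrite /normalized_mass ltr_pdivrMr//.
exact: le_lt_trans (ler_norm _) h.
Qed.

End FunctionalRepresentation.

Lemma representation_of_functional (R : realType) (E : rieszType R) :
  archimedean E -> universally_complete E ->
  (exists e : E, weak_order_unit e /\
     exists phi : {scalar (principal_ideal e)},
       strictly_positive phi /\ order_continuous phi) ->
  exists (d : measure_display) (X : measurableType d) (mu : probability X R)
     (T : {linear E -> L0 mu}),
     lattice_isomorphism T /\ range T = [set: L0 mu].
Proof.
move=> E_arch [E_lat E_dc] [e [eu [phi [phi_pos phi_cont]]]].
have [e0 _] := eu.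
exact: (stone_representation E_arch E_dc (ltW e0) (weak_order_unit_meet_le0 eu)
  (normalized_massP e0 phi_pos phi_cont) E_lat).
Qed.

(** * Riesz spaces isomorphic to L0 *)

Section ProbabilityIntegral.
Context d (X : measurableType d) (R : realType) (mu : probability X R).
Implicit Types f g : X -> R.

Definition ae_bounded f := exists l : R, {ae mu, forall x, `|f x| <= l}.

Lemma ae_bounded_integrable f : measurable_fun setT f -> ae_bounded f ->
  mu.-integrable setT (EFin \o f).
Proof.
move=> mf [l fl]; apply/integrableP; split; first exact/measurable_EFinP.
apply: (@le_lt_trans _ _ (\int[mu]_x (`|l|%:E))%E).
  apply: ae_ge0_le_integral => //.
  - by apply/measurableT_comp => //; exact/measurable_EFinP.
  - by apply: aeS fl => x fx _; rewrite /= lee_fin (le_trans fx)// ler_norm.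
rewrite integral_cst// [X in (_ * X)%E](_ : _ = 1%E) ?mule1 ?ltry//.
exact: probability_setT.
Qed.

Lemma ae_eq_Rintegral f g : measurable_fun setT f -> measurable_fun setT g ->
  {ae mu, forall x, f x = g x} -> \int[mu]_x f x = \int[mu]_x g x.
Proof.
move=> mf mg fg; rewrite /Rintegral; congr fine; apply: ae_eq_integral => //.
- exact/measurable_EFinP.
- exact/measurable_EFinP.
- by apply: aeS fg => x /= -> _.
Qed.

Lemma le_ae_Rintegral f g : measurable_fun setT f -> measurable_fun setT g ->
  ae_bounded f -> ae_bounded g ->
  {ae mu, forall x, f x <= g x} -> \int[mu]_x f x <= \int[mu]_x g x.
Proof.
move=> mf mg bf bg fg; rewrite -subr_ge0 -RintegralB//; try exact: ae_bounded_integrable.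
(* The positive part of [g - f] is nonnegative everywhere and not just almost everywhere. *)
rewrite (@ae_eq_Rintegral _ (fun x => Num.max (g x - f x) 0)).
- by apply: Rintegral_ge0 => x _; rewrite le_max lexx orbT.
- exact: measurable_funB.
- by apply: measurable_maxr => //; exact: measurable_funB.
- by apply: aeS fg => x fgx; rewrite max_l// subr_ge0.
Qed.

Lemma ae_Rintegral_eq0 f : measurable_fun setT f -> ae_bounded f ->
  {ae mu, forall x, 0 <= f x} -> \int[mu]_x f x = 0 ->
  {ae mu, forall x, f x = 0}.
Proof.
move=> mf bf f0 int0; have mEf : measurable_fun setT (EFin \o f).
  exact/measurable_EFinP.
have : (\int[mu]_x `|(EFin \o f) x| = 0)%E.
  have <- : (\int[mu]_x (EFin \o f) x = \int[mu]_x `|(EFin \o f) x|)%E.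
    apply: ae_eq_integral => //; first exact: measurableT_comp.
    by apply: aeS f0 => x fx _ /=; rewrite ger0_norm.
  rewrite -[LHS]fineK; first by rewrite [fine _]int0.
  exact: integrable_fin_num (ae_bounded_integrable mf bf).
move/(ae_eq_integral_abs _ measurableT mEf).
by apply: aeS => x /(_ Logic.I)[].
Qed.

End ProbabilityIntegral.

(** * Completeness of a space isomorphic to L0 *)

Section L0Representation.
Context d (X : measurableType d) (R : realType) (mu : probability X R).
Variables (E : rieszType R) (T : {linear E -> L0 mu}).
Hypothesis T_iso : lattice_isomorphism T.
Hypothesis T_surj : range T = [set: L0 mu].
Implicit Types (x y z : E).

Definition L0_rep x : X -> R := L0_fun (T x).
Local Notation tau := L0_rep.

Lemma measurable_L0_rep x : measurable_fun setT (tau x).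
Proof. exact: measurable_funPT. Qed.

Lemma L0_repD x y : {ae mu, forall t, tau (x + y) t = tau x t + tau y t}.
Proof. by rewrite /tau linearD; exact: L0_funD. Qed.

Lemma L0_repZ a x : {ae mu, forall t, tau (a *: x) t = a * tau x t}.
Proof. by rewrite /tau linearZ; exact: L0_funZ. Qed.

Lemma L0_repN x : {ae mu, forall t, tau (- x) t = - tau x t}.
Proof.
by rewrite -scaleN1r; apply: aeS (L0_repZ (-1) x) => t ->; rewrite mulN1r.
Qed.

Lemma L0_rep0 : {ae mu, forall t, tau 0 t = 0}.
Proof.
by rewrite -(scale0r (0 : E)); apply: aeS (L0_repZ 0 0) => t ->; rewrite mul0r.
Qed.

Lemma L0_rep_meet x y :
  {ae mu, forall t, tau (x ⊓ y) t = Num.min (tau x t) (tau y t)}.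
Proof. by have [_ + _] := T_iso; rewrite /tau => ->; exact: L0_fun_meet. Qed.

Lemma L0_rep_join x y :
  {ae mu, forall t, tau (x ⊔ y) t = Num.max (tau x t) (tau y t)}.
Proof. by have [_ _] := T_iso; rewrite /tau => ->; exact: L0_fun_join. Qed.

Lemma L0_rep_inj x y : {ae mu, forall t, tau x t = tau y t} -> x = y.
Proof. by have [Ti _ _] := T_iso; move=> /L0_funP /Ti. Qed.

Lemma L0_rep_le x y : x <= y <-> {ae mu, forall t, tau x t <= tau y t}.
Proof.
split=> [/riesz_meet_l xy|xy].
  apply: aeS (L0_rep_meet x y) => t; rewrite xy => ->.
  by rewrite ge_min lexx orbT.
rewrite -(_ : x ⊓ y = x) ?riesz_leIr//; apply: L0_rep_inj.
by apply: aeS (aeI (L0_rep_meet x y) xy) => t [-> h]; rewrite min_l.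
Qed.

Lemma L0_rep_surj (g : X -> R) : measurable_fun setT g ->
  exists x, {ae mu, forall t, tau x t = g t}.
Proof.
move=> mg; pose f : {mfun X >-> R} := mfun_Sub (mem_set mg).
have : range T (L0_class mu f) by rewrite T_surj.
by move=> [x _ xf]; exists x; rewrite /tau xf; exact: L0_classK.
Qed.

Lemma L0_rep_ge0 x : 0 <= x <-> {ae mu, forall t, 0 <= tau x t}.
Proof.
by split=> [/L0_rep_le h|h]; [|apply/L0_rep_le];
  apply: aeS (aeI L0_rep0 h) => t [->].
Qed.

Lemma L0_rep_le0 x : x <= 0 <-> {ae mu, forall t, tau x t <= 0}.
Proof.
by split=> [/L0_rep_le h|h]; [|apply/L0_rep_le];
  apply: aeS (aeI L0_rep0 h) => t [->].
Qed.

Lemma L0_rep_abs x : {ae mu, forall t, tau (riesz_abs x) t = `|tau x t|}.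
Proof.
apply: aeS (aeI (L0_rep_join x (- x)) (L0_repN x)) => t [-> ->].
by rewrite maxrN.
Qed.

(** Being bounded and strictly increasing, [atan] makes suprema finite and integrable and keeps the
    order. *)
Let h t : R := atan t.
Let hsup (u : nat -> E) (t : X) : R := sups (fun n => h (tau (u n) t)) 0.

Let h_ub (u : nat -> E) t : has_ubound (range (fun n => h (tau (u n) t))).
Proof. by exists (pi / 2) => _ [n _ <-]; exact/ltW/atan_ltpi2. Qed.

Let hsup_ge u t n : h (tau (u n) t) <= hsup u t.
Proof. by apply: ub_le_sup; [exact/has_ubound_sdrop|exists n]. Qed.

Let hsup_le u t b : (forall n, h (tau (u n) t) <= b) -> hsup u t <= b.
Proof.
move=> ub; apply: ge_sup; first by exists (h (tau (u 0%N) t)), 0%N.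
by move=> _ [n _ <-].
Qed.

Let measurable_hsup u : measurable_fun setT (hsup u).
Proof.
apply: measurable_fun_sups => // n.
apply: measurableT_comp; last exact: measurable_L0_rep.
by apply: continuous_measurable_fun => t; exact: continuous_atan.
Qed.

Let bounded_hsup u : ae_bounded mu (hsup u).
Proof.
exists (pi / 2); apply: aeW => t; rewrite ler_norml; apply/andP; split.
  by apply: le_trans (hsup_ge u t 0%N); exact/ltW/atan_gtNpi2.
by apply: hsup_le => n; exact/ltW/atan_ltpi2.
Qed.

(* A sequence maximizing the integral of sup_n atan (u_n) cannot be improved
   by adding another element of A. *)
Lemma L0_rep_countable_sup (A : set E) : A !=set0 -> exists u : nat -> E,
  (forall n, A (u n)) /\ (forall b, (forall n, u n <= b) -> ubound A b).
Proof.
move=> [a0 Aa0].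
pose F u := \int[mu]_t hsup u t.
have F_le u v : (forall t, hsup u t <= hsup v t) -> F u <= F v.
  by move=> uv; apply: le_ae_Rintegral => //; exact: aeW.
pose S := [set F u | u in [set u : nat -> E | forall n, A (u n)]].
have S_sup : has_sup S.
  split; first by exists (F (fun=> a0)), (fun=> a0).
  exists (\int[mu]_t (pi / 2)) => _ [u _ <-]; apply: le_ae_Rintegral => //.
    by exists `|pi / 2|; exact: aeW.
  by apply: aeW => t; apply: hsup_le => n; exact/ltW/atan_ltpi2.
have /choice[w wP] : forall k : nat, exists u, (forall n, A (u n)) /\
    sup S - k.+1%:R^-1 < F u.
  move=> k; have k0 : 0 < k.+1%:R^-1 :> R by rewrite invr_gt0.
  by have [_ [u Au <-] Fu] := sup_adherent k0 S_sup; exists u.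
(* [u] runs through all the sequences [w i]; a number that encodes no pair is sent to [(0, 0)]. *)
pose u n := let: (i, j) := odflt (0%N, 0%N) (unpickle n) in w i j.
have Au n : A (u n).
  by rewrite /u; case: (odflt _ _) => i j; case: (wP i).
have wu k : F (w k) <= F u.
  apply: F_le => t; apply: hsup_le => n.
  by have := hsup_ge u t (pickle (k, n)); rewrite /u pickleK.
have Fu : sup S <= F u.
  apply/ler_addgt0Pr => eps eps0.
  have h0 : 0 <= eps^-1 by rewrite invr_ge0 ltW.
  have [_ h1] := wP (Num.bound eps^-1).
  have h2 : (Num.bound eps^-1).+1%:R^-1 <= eps.
    rewrite invf_ple ?posrE//.
    by apply: le_trans (ltW (archi_boundP h0)) _; rewrite ler_nat leqnSn.
  rewrite -lerBlDr; apply: le_trans (wu (Num.bound eps^-1)).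
  by apply/ltW/(le_lt_trans _ h1); rewrite lerD2l lerN2.
exists u; split=> // b ub g Ag.
(* Putting [g] in front of [u] cannot raise the maximal integral, so both suprema agree almost
   everywhere: [atan] of [g] stays below the supremum along [u], hence below [atan] of [b]. *)
pose v n := if n is n'.+1 then u n' else g.
have Fv : F v <= F u.
  apply: le_trans Fu; apply: ub_le_sup; first by case: S_sup.
  by exists v => // -[].
have uv t : hsup u t <= hsup v t.
  by apply: hsup_le => n; exact: (hsup_ge v t n.+1).
have uvE : {ae mu, forall t, hsup v t - hsup u t = 0}.
  apply: ae_Rintegral_eq0.
  - exact: measurable_funB.
  - have [l ul] := bounded_hsup u; have [k vk] := bounded_hsup v.
    exists (k + l); apply: aeS (aeI ul vk) => t [h1 h2].
    by rewrite (le_trans (ler_normB _ _))// lerD.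
  - by apply: aeW => t; rewrite subr_ge0.
  rewrite RintegralB//; try exact: ae_bounded_integrable.
  by apply/eqP; rewrite subr_eq0 eq_le Fv F_le.
have ub' n : {ae mu, forall t, tau (u n) t <= tau b t} by apply/L0_rep_le.
apply/L0_rep_le; apply: aeS (aeI uvE (ae_forall ub')) => t [/subr0_eq uvt ubt].
rewrite leNgt; apply/negP => /lt_atan; apply/negP; rewrite -leNgt.
apply: le_trans (hsup_ge v t 0%N) _; rewrite uvt; apply: hsup_le => n.
exact: le_atan.
Qed.

(** The pointwise supremum of the representatives is measurable, and [T] being onto it represents
    some [s]. The last clause keeps the pointwise information that pure order language loses. *)
Lemma L0_rep_seq_sup (u : nat -> E) :
  {ae mu, forall t, exists b, forall n, tau (u n) t <= b} ->
  exists s, isLub (range u) s /\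
    {ae mu, forall t b, (forall n, tau (u n) t <= b) -> tau s t <= b}.
Proof.
move=> u_ub; pose g t := fine (esups (fun n => (tau (u n) t)%:E) 0).
have mg : measurable_fun setT g.
  apply: measurableT_comp => //; apply: measurable_fun_esups => n.
  exact/measurable_EFinP/measurable_L0_rep.
have gE t : (exists b, forall n, tau (u n) t <= b) ->
    (forall n, tau (u n) t <= g t) /\
    forall b, (forall n, tau (u n) t <= b) -> g t <= b.
  move=> [b ub].
  have rub : has_ubound (range (fun n => tau (u n) t)) by exists b => _ [n _ <-].
  have rn0 : (range (fun n => tau (u n) t)) !=set0 by exists (tau (u 0%N) t), 0%N.
  have -> : g t = sup (range (fun n => tau (u n) t)).
    rewrite /g -[RHS]/(fine (sup (range (fun n => tau (u n) t)))%:E).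
    rewrite -ereal_sup_EFin//; congr (fine (ereal_sup _)).
    apply/seteqP; split=> [_ [n _ <-]|_ [_ [n _ <-] <-]]; last by exists n.
    by exists (tau (u n) t) => //; exists n.
  split=> [n|c uc]; first by apply: ub_le_sup => //; exists n.
  by apply: ge_sup => // _ [n _ <-].
have [s sg] := L0_rep_surj mg; exists s; split; first split.
- move=> _ [n _ <-]; apply/L0_rep_le; apply: aeS (aeI sg u_ub) => t [-> /gE[+ _]].
  exact.
- move=> b ub; apply/L0_rep_le.
  have ub' n : {ae mu, forall t, tau (u n) t <= tau b t}.
    by apply/L0_rep_le/ub; exists n.
  apply: aeS (aeI sg (aeI u_ub (ae_forall ub'))) => t [-> [/gE[_ +] ubt]].
  exact.
- by apply: aeS (aeI sg u_ub) => t [-> /gE[_ +]] b; exact.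
Qed.

Lemma L0_rep_dedekind : dedekind_complete E.
Proof.
move=> A [A0 [b Ab]]; have [u [Au uA]] := L0_rep_countable_sup A0.
have [s [[us su] _]] : exists s, isLub (range u) s /\
    {ae mu, forall t b, (forall n, tau (u n) t <= b) -> tau s t <= b}.
  apply: L0_rep_seq_sup.
  have ub n : {ae mu, forall t, tau (u n) t <= tau b t} by apply/L0_rep_le/Ab.
  by apply: aeS (ae_forall ub) => t ubt; exists (tau b t).
exists s; split.
  by apply: uA => n; apply: us; exists n.
by move=> c Ac; apply: su => _ [n _ <-]; exact: Ac.
Qed.

(** Distinct members of [D] are disjoint, so at almost every point all nonzero values of the
    sequence [u] coincide. The sequence is then bounded pointwise, which suffices for its supremum
    to exist. *)
Lemma L0_rep_lateral : laterally_complete E.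
Proof.
move=> D D0 D_ge0 D_disj; have [u [Du uD]] := L0_rep_countable_sup D0.
have u_ge0 n : {ae mu, forall t, 0 <= tau (u n) t} by apply/L0_rep_ge0/D_ge0.
have u_disj i j : {ae mu, forall t, tau (u i) t = tau (u j) t \/
    Num.min (tau (u i) t) (tau (u j) t) = 0}.
  have [<-|uij] := pselect (u i = u j); first by apply: aeW => t; left.
  have := D_disj _ _ (Du i) (Du j) uij.
  rewrite /riesz_disjoint !riesz_ge0_abs ?D_ge0// => dij.
  apply: aeS (aeI L0_rep0 (L0_rep_meet (u i) (u j))) => t [t0 h2].
  by right; rewrite -h2 dij.
have [s [[us su] _]] : exists s, isLub (range u) s /\
    {ae mu, forall t b, (forall n, tau (u n) t <= b) -> tau s t <= b}.
  apply: L0_rep_seq_sup.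
  apply: aeS (aeI (ae_forall u_ge0) (ae_forall (fun i => ae_forall (u_disj i)))).
  move=> t [t0 td]; have [[i ti]|nt] := pselect (exists i, 0 < tau (u i) t).
    exists (tau (u i) t) => n; case: (td i n) => [->//|].
    case: (leP (tau (u i) t) (tau (u n) t)) => [_ ti0|_ ->]; last exact: ltW.
    by move: ti; rewrite ti0 ltxx.
  exists 0 => n; rewrite leNgt; apply/negP => tn; apply: nt; by exists n.
exists s; split.
  by apply: uD => n; apply: us; exists n.
by move=> c Ac; apply: su => _ [n _ <-]; exact: Ac.
Qed.

End L0Representation.

(** * The constant function 1 and the integral *)

Section L0Functional.
Context d (X : measurableType d) (R : realType) (mu : probability X R).
Variables (E : rieszType R) (T : {linear E -> L0 mu}).
Hypothesis T_iso : lattice_isomorphism T.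
Hypothesis T_surj : range T = [set: L0 mu].
Variable e : E.
Local Notation tau := (L0_rep T).
Hypothesis e1 : {ae mu, forall t, tau e t = 1}.

Lemma L0_rep_unit_ge0 : 0 <= e.
Proof. by apply/(L0_rep_ge0 T_iso); apply: aeS e1 => t ->. Qed.

Lemma L0_rep_unit_gt0 : 0 < e.
Proof.
rewrite lt_neqAle L0_rep_unit_ge0 andbT; apply/eqP => e0.
have [A [mA A0 hA]] : {ae mu, forall t : X, False}.
  apply: aeS (aeI e1 (L0_rep0 T)) => t []; rewrite -e0 => -> /eqP.
  by rewrite oner_eq0.
have AT : A = setT by apply/seteqP; split=> // t _; apply: hA => /=.
have muT : (mu setT = 1)%E by exact: probability_setT.
by move: muT; rewrite -AT A0 => /esym/eqP; rewrite onee_eq0.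
Qed.

(** The distance from [t] to the interval between [- c] and [c] is the positive part of [|t| - c],
    which decreases in [c]. *)
Lemma clamp_dist (t a b : R) : 0 <= a -> a <= b ->
  `|Num.max (Num.min t b) (- b) - t| <= `|Num.max (Num.min t a) (- a) - t|.
Proof.
move=> a0 ab; have b0 : 0 <= b by exact: le_trans ab.
have clampE c : 0 <= c -> `|Num.max (Num.min t c) (- c) - t| = Num.max (`|t| - c) 0.
  move=> c0; case: (leP t c) => ?; case: (leP _ (- c)) => ?;
    case: (ger0P t) => ?; case: (leP _ 0) => ?; case: ger0P => ?; lra.
rewrite !clampE// ge_max !le_max lexx !orbT andbT; apply/orP; left.
by rewrite lerD2l lerN2.
Qed.

(** The truncations [u n] of [x] between [- (n%:R *: e)] and [n%:R *: e] lie in the ideal. Their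
    distances to [x] decrease, and at almost every point they vanish once [n] exceeds the absolute
    value of [x] there. *)
Lemma L0_rep_weak_order_unit : weak_order_unit e.
Proof.
split; first exact: L0_rep_unit_gt0.
move=> x; have e0 := L0_rep_unit_ge0.
pose u (n : nat) := (x ⊓ (n%:R *: e)) ⊔ (- (n%:R *: e)).
pose y n := riesz_abs (u n - x).
have uE : {ae mu, forall t n,
    tau (y n) t = `|Num.max (Num.min (tau x t) n%:R) (- n%:R) - tau x t|}.
  apply: ae_forall => n.
  apply: aeS (aeI (aeI (L0_rep_abs T_iso (u n - x))
      (aeI (L0_repD T (u n) (- x)) (L0_repN T x)))
    (aeI (aeI (L0_rep_join T_iso (x ⊓ (n%:R *: e)) (- (n%:R *: e)))
      (L0_rep_meet T_iso x (n%:R *: e)))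
      (aeI (L0_repN T (n%:R *: e)) (aeI (L0_repZ T n%:R e) e1)))).
  by move=> t [[-> [-> ->]] [[-> ->] [-> [-> ->]]]]; rewrite mulr1.
have ne0 n : 0 <= (n%:R : R) *: e by rewrite riesz_scaler_ge0.
exists nat, (fun a b => (a <= b)%N), u; split.
- split; [by exists 0%N|by []|by move=> a b c; exact: leq_trans|].
  by move=> a b; exists (maxn a b); rewrite leq_maxl leq_maxr.
- move=> n; apply/in_idealP; exists n%:R; rewrite riesz_leUr riesz_leUx riesz_leIr/=.
  by apply: le_trans (ne0 n); rewrite riesz_leN0.
exists y; split; last by [].
split.
  move=> a b ab; apply/(L0_rep_le T_iso); apply: aeS uE => t yE.
  by rewrite !yE; apply: clamp_dist; rewrite ?ler_nat.
split=> [_ [n _ <-]|z zy]; first exact: riesz_abs_ge0.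
have zy' n : {ae mu, forall t, tau z t <= tau (y n) t}.
  by apply/(L0_rep_le T_iso)/zy; exists n.
apply/(L0_rep_le0 T_iso); apply: aeS (aeI uE (ae_forall zy')) => t [yE zyt].
pose n := Num.bound `|tau x t|.
have xn : `|tau x t| <= n%:R by exact/ltW/archi_boundP.
apply: le_trans (zyt n) _; rewrite yE.
move: xn; rewrite ler_norml => /andP[xn1 xn2].
by rewrite min_l// max_l// subrr normr0.
Qed.

(** * The integral on the principal ideal *)

Local Notation I := (principal_ideal e).
Implicit Types f g : I.

Let tau_bounded f : ae_bounded mu (tau f).
Proof.
have /in_idealP[l /andP[/(L0_rep_le T_iso) lf /(L0_rep_le T_iso) fl]] := ideal_valP f.
exists l; apply: aeS (aeI (aeI lf fl)
  (aeI (L0_repN T (l *: e)) (aeI (L0_repZ T l e) e1))).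
move=> t [[h1 h2] [h3 [h4 h5]]]; rewrite h4 h5 mulr1 in h2 h3.
by rewrite ler_norml h2 andbT -h3.
Qed.

Let tau_integrable f : mu.-integrable setT (EFin \o tau f).
Proof. exact: (ae_bounded_integrable (measurable_L0_rep T f) (tau_bounded f)). Qed.

Definition L0_integral f : R := \int[mu]_t tau f t.

Lemma L0_integral_linear : linear_for *%R L0_integral.
Proof.
move=> a f g; rewrite /L0_integral -RintegralZl// -RintegralD//; last first.
  have := integrableZl measurableT a (tau_integrable f).
  by apply: eq_integrable => // t _ /=; rewrite EFinM.
apply: ae_eq_Rintegral.
- exact: measurable_L0_rep.
- apply: measurable_funD; last exact: measurable_L0_rep.
  by apply: measurable_funM => //; exact: measurable_L0_rep.
- apply: aeS (aeI (L0_repD T (a *: ideal_val f) (ideal_val g))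
    (L0_repZ T a (ideal_val f))).
  by move=> t [h1 h2]; rewrite -h2 -h1.
Qed.

HB.instance Definition _ :=
  GRing.isLinear.Build R I R *%R L0_integral L0_integral_linear.

Let phi : {scalar I} := L0_integral.

Lemma le_L0_integral f g : ideal_val f <= ideal_val g -> phi f <= phi g.
Proof.
move=> fg; apply: le_ae_Rintegral => //; try exact: measurable_L0_rep.
exact/(L0_rep_le T_iso).
Qed.

Lemma L0_integral_strictly_positive : strictly_positive phi.
Proof.
move=> f f0; have f0' : 0 <= ideal_val f by exact: ltW f0.
rewrite lt_neqAle; apply/andP; split; last first.
  by rewrite -(linear0 phi); apply: le_L0_integral.
apply/negP => /eqP/esym h; move: f0; rewrite lt_neqAle => /andP[/negP + _]; apply.
apply/eqP/esym/val_inj; apply: (L0_rep_inj T_iso).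
have := ae_Rintegral_eq0 (measurable_L0_rep T f) (tau_bounded f) _ h.
move=> /(_ ((L0_rep_ge0 T_iso _).1 f0')) f0''.
by apply: aeS (aeI (L0_rep0 T) f0'') => t [-> ->].
Qed.

(** The infimum [0] is expressed as the supremum of the opposites, so that [L0_rep_seq_sup] turns it
    into pointwise convergence almost everywhere. Dominated convergence with bound [y 0]
    concludes. *)
Lemma L0_integral_seq_cvg0 (y : nat -> I) :
  (forall a b, (a <= b)%N -> ideal_val (y b) <= ideal_val (y a)) ->
  isLub (range (fun n => - ideal_val (y n))) 0 ->
  phi (y n) @[n --> \oo] --> (0 : R).
Proof.
move=> y_dec [yle0 y_lub].
have y0 n : 0 <= ideal_val (y n) by rewrite -riesz_leN0; apply: yle0; exists n.
have Ny_ub : {ae mu, forall t, exists b, forall n, tau (- ideal_val (y n)) t <= b}.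
  have h n : {ae mu, forall t, tau (- ideal_val (y n)) t <= 0}.
    by apply/(L0_rep_le0 T_iso); rewrite riesz_leN0.
  by apply: aeS (ae_forall h) => t ht; exists 0.
have [s [s_lub sP]] := L0_rep_seq_sup T_iso T_surj Ny_ub.
have s0 : s = 0 by apply: riesz_isLub_uniq s_lub _; split.
rewrite {}s0 in sP.
have tau_y_ge0 : {ae mu, forall t n, 0 <= tau (y n) t}.
  by apply: ae_forall => n; apply/(L0_rep_ge0 T_iso).
have tau_y_dec : {ae mu, forall t n, tau (y n.+1) t <= tau (y n) t}.
  by apply: ae_forall => n; apply/(L0_rep_le T_iso)/y_dec.
have NyE : {ae mu, forall t n, tau (- ideal_val (y n)) t = - tau (y n) t}.
  by apply: ae_forall => n; exact: L0_repN.
have dec t : (forall n, tau (y n.+1) t <= tau (y n) t) ->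
    forall a b, (a <= b)%N -> tau (y b) t <= tau (y a) t.
  move=> ht a; elim=> [|b IH]; first by rewrite leqn0 => /eqP ->.
  by rewrite leq_eqVlt => /predU1P[->//|/IH]; exact: le_trans (ht b).
have y_cvg : {ae mu, forall t, setT t ->
    (EFin \o tau (y n)) t @[n --> \oo] --> (cst 0%E : X -> \bar R) t}.
  apply: aeS (aeI (aeI tau_y_ge0 tau_y_dec) (aeI NyE (aeI sP (L0_rep0 T)))).
  move=> t [[t0 /dec td] [tN [ts tau0]]] _ /=.
  apply: cvg_EFin; first exact: nearW.
  apply/cvgrPdist_lt => eps eps0.
  have [n yn] : exists n, tau (y n) t < eps.
    apply: contrapT => /forallNP hn; have : tau 0 t <= - eps.
      by apply: ts => n; rewrite tN lerN2 leNgt; apply/negP/hn.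
    by rewrite tau0 leNgt oppr_lt0 eps0.
  exists n => // k /= nk; rewrite sub0r normrN ger0_norm//.
  exact: le_lt_trans (td _ _ nk) yn.
have y_dom : {ae mu, forall t n, setT t ->
    (`|(EFin \o tau (y n)) t| <= (EFin \o tau (y 0%N)) t)%E}.
  apply: aeS (aeI tau_y_ge0 tau_y_dec) => t [t0 /dec td] n _.
  by rewrite /= lee_fin ger0_norm// td.
have [_ _] := dominated_convergence measurableT
  (fun n => measurable_int _ (tau_integrable (y n))) (measurable_cst 0%E)
  y_cvg (tau_integrable (y 0%N)) y_dom.
by rewrite integral0 => /fine_cvgP[].
Qed.

(** Countably many indices [a n] already determine the infimum of the dominating net, which reduces
    the claim to an increasing sequence of indices. Beyond [b n], monotonicity bounds the integral
    by that of [y (b n)]. *)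
Lemma L0_integral_order_continuous : order_continuous phi.
Proof.
move=> A leA u [[a0 _] leAxx leA_trans leA_dir] [y [[y_dec [y_ge0 y_inf]] uy]].
have [w [wA w_ub]] := @L0_rep_countable_sup _ _ _ _ _ _ T_iso
  (range (fun a => - ideal_val (y a))) (ex_intro _ _ (ex_intro2 _ _ a0 Logic.I erefl)).
have /choice[a aE] : forall n, exists a, - ideal_val (y a) = w n.
  by move=> n; have [a _ <-] := wA n; exists a.
have /choice[j jP] : forall p : A * A, exists c, leA p.1 c /\ leA p.2 c.
  by move=> [p q]; exact: leA_dir.
(* Each [b n] is chosen beyond both its predecessor and [a n]. *)
pose fix b n := if n is n'.+1 then j (b n', a n) else a 0%N.
have bS n : leA (b n) (b n.+1) by have [] := jP (b n, a n.+1).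
have ab n : leA (a n) (b n).
  by case: n => [|n]; [exact: leAxx|have [] := jP (b n, a n.+1)].
have b_le m n : (m <= n)%N -> leA (b m) (b n).
  elim: n => [|n IH]; first by rewrite leqn0 => /eqP ->; exact: leAxx.
  by rewrite leq_eqVlt => /predU1P[->|/IH h]; [exact: leAxx|exact: leA_trans (bS n)].
have y0 c : 0 <= ideal_val (y c) by apply: (y_ge0 (y c)); exists c.
have yb_lub : isLub (range (fun n => - ideal_val (y (b n)))) 0.
  split=> [_ [n _ <-]|z zb]; first by rewrite riesz_leN0.
  (* The infimum hypothesis only concerns elements of the ideal. Cutting at [0] puts [- z'] between
     [0] and [y (b 0)], hence in the ideal. *)
  pose z' := z ⊓ 0.
  have z'b n : - ideal_val (y (b n)) <= z'.
    by rewrite riesz_lexI riesz_leN0 y0 andbT; apply: zb; exists n.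
  have z'I : - z' \in in_ideal e.
    have /in_idealP[l /andP[_ yl]] := ideal_valP (y (b 0%N)).
    have z'l : - z' <= l *: e.
      by apply: le_trans yl; rewrite -riesz_leN opprK.
    have Nz'0 : 0 <= - z' by rewrite riesz_le0N riesz_leIr.
    apply/in_idealP; exists l; rewrite z'l andbT (le_trans _ Nz'0)// riesz_leN0.
    exact: le_trans z'l.
  have : PrincipalIdeal z'I <= 0.
    apply: y_inf => _ [c _ <-].
    suff : - ideal_val (y c) <= z' by rewrite -riesz_leN opprK.
    apply: w_ub; last by exists c.
    move=> n; rewrite -aE; apply: le_trans (z'b n); rewrite riesz_leN.
    exact: (y_dec _ _ (ab n)).
  rewrite [_ <= _](_ : _ = (- z' <= 0))// riesz_leN0 => z'0.
  by apply: le_trans z'0 _; exact: riesz_leIl.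
have /cvgrPdist_lt yb0 :=
  L0_integral_seq_cvg0 (fun m n mn => y_dec _ _ (b_le m n mn)) yb_lub.
have FF : Filter (net_tails leA).
  apply: filter_from_filter; first by exists a0.
  move=> p q _ _; have [c [pc qc]] := leA_dir p q.
  by exists c => // r cr; split; [exact: leA_trans cr|exact: leA_trans cr].
apply/cvgrPdist_lt => eps eps0.
have [n _ /(_ n (leqnn n))] := yb0 _ eps0; rewrite sub0r normrN => yn.
exists (b n) => // c /= bc; rewrite sub0r normrN.
apply: le_lt_trans (le_lt_trans (ler_norm _) yn).
have ub : riesz_abs (ideal_val (u c)) <= ideal_val (y (b n)).
  have h1 : ideal_val (y c) <= ideal_val (y (b n)) := y_dec _ _ bc.
  by apply: le_trans h1; have := uy c; rewrite subr0.
move: ub; rewrite riesz_absP => /andP[u1 u2].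
rewrite ler_norml; apply/andP; split; last exact: le_L0_integral.
by rewrite -(linearN phi); apply: le_L0_integral.
Qed.

Lemma L0_integral_functional : exists phi : {scalar I},
  strictly_positive phi /\ order_continuous phi.
Proof.
exists phi; split; first exact: L0_integral_strictly_positive.
exact: L0_integral_order_continuous.
Qed.

End L0Functional.

Theorem corollary2p3 (R : realType) (E : rieszType R) (E_arch : archimedean E) :
  (exists (d : measure_display) (X : measurableType d) (mu : probability X R)
     (T : {linear E -> L0 mu}),
     lattice_isomorphism T /\ range T = [set: L0 mu])
  <->
  (universally_complete E /\
   exists e : E, weak_order_unit e /\
     exists phi : {scalar (principal_ideal e)},
       strictly_positive phi /\ order_continuous phi).
Proof.
split=> [[d [X [mu [T [T_iso T_surj]]]]]|[E_uc E_phi]]; last first.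
  exact: representation_of_functional.
split; first split.
- exact: L0_rep_lateral T_iso T_surj.
- exact: L0_rep_dedekind T_iso T_surj.
have [e e1] := L0_rep_surj T_surj (measurable_cst (1 : R)).
exists e; split; first exact: (L0_rep_weak_order_unit T_iso e1).
exact: (L0_integral_functional T_iso T_surj e1).
Qed.
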